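(* Let $M$ be a program, let $m=|M|$ be its size, and let $d$ be the depth of a $\mathbf{DLAL_B}$ derivation of $;\vdash M:\S^n\mathbf{Bool}$. Then the abstract alternating machine $\mathcal{K}_{\mathcal{B}}$ on input $M$ computes in time bounded by $m^{3^{d+3}}$ (every path of its computation tree starting at the initial configuration has length at most $m^{3^{d+3}}$).
   Context: System $\mathbf{DLAL_B}$. Types: $A,B::=\alpha\mid A\multimap B\mid A\Rightarrow B\mid \S A\mid \forall\alpha.A\mid \mathbf{Bool}$. Terms of $\Lambda_B$: $t,u,v::=x\mid F\mid T\mid \lambda x.t\mid t\,u\mid \mathrm{if}\ t\ \mathrm{then}\ u\ \mathrm{else}\ v$; the size $|t|$ is the number of symbol occurrences. Judgements are $\Gamma;\Delta\vdash t:A$ where $\Gamma$ (non-linear) and $\Delta$ (linear) assign types to distinct variables, with disjoint domains. Rules: (Id) $;x:A\vdash x:A$. ($\multimap$i) from $\Gamma;\Delta,x:A\vdash t:B$ infer $\Gamma;\Delta\vdash\lambda x.t:A\multimap B$. ($\multimap$e) from $\Gamma_1;\Delta_1\vdash t:A\multimap B$ and $\Gamma_2;\Delta_2\vdash u:A$ infer $\Gamma_1,\Gamma_2;\Delta_1,\Delta_2\vdash t\,u:B$. ($\Rightarrow$i) from $\Gamma,x:A;\Delta\vdash t:B$ infer $\Gamma;\Delta\vdash \lambda x.t:A\Rightarrow B$. ($\Rightarrow$e) from $\Gamma;\Delta\vdash t:A\Rightarrow B$ and $;z:C\vdash u:A$ infer $\Gamma,z:C;\Delta\vdash t\,u:B$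 (the right premise may also be $;\vdash u:A$, with conclusion $\Gamma;\Delta\vdash t\,u:B$). (Weak) from $\Gamma_1;\Delta_1\vdash t:A$ infer $\Gamma_1,\Gamma_2;\Delta_1,\Delta_2\vdash t:A$. (Cntr) from $x_1:A,x_2:A,\Gamma;\Delta\vdash t:B$ infer $x:A,\Gamma;\Delta\vdash t[x/x_1,x/x_2]:B$. ($\S$i) from $;\Gamma,\Delta\vdash t:A$ infer $\Gamma;\S\Delta\vdash t:\S A$ ($\S\Delta$ prefixes $\S$ to every type of $\Delta$). ($\S$e) from $\Gamma_1;\Delta_1\vdash u:\S A$ and $\Gamma_2;x:\S A,\Delta_2\vdash t:B$ infer $\Gamma_1,\Gamma_2;\Delta_1,\Delta_2\vdash t[u/x]:B$. ($\forall$i) from $\Gamma;\Delta\vdash t:A$ infer $\Gamma;\Delta\vdash t:\forall\alpha.A$ if $\alpha$ is not free in $\Gamma,\Delta$. ($\forall$e) from $\Gamma;\Delta\vdash t:\forall\alpha.A$ infer $\Gamma;\Delta\vdash t:A[B/\alpha]$. ($B_0$i) $;\vdash F:\mathbf{Bool}$; ($B_1$i) $;\vdash T:\mathbf{Bool}$. ($B$e) from $\Gamma;\Delta\vdash M_0:\S^k\mathbf{Bool}$ ($k\in\mathbb{N}$), $\Gamma;\Delta\vdash M_1:A$, $\Gamma;\Delta\vdash M_2:A$ infer $\Gamma;\Delta\vdash \mathrm{if}\ M_0\ \mathrm{then}\ M_1\ \mathrm{else}\ M_2:A$. The depth of a derivation is the maximal number, along a branch, of premises of ($\S$i) rules and right-hand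 premises of ($\Rightarrow$e) rules. A program is a term $M$ with $;\vdash M:\S^n\mathbf{Bool}$ for some $n\in\mathbb{N}$. Machine $\mathcal{K}_{\mathcal{B}}$. A context $\mathcal{A}$ is a finite sequence of assignments $x_i:=t_i$ with distinct $x_i$; $\emptyset$ is the empty one and $@$ denotes concatenation. Configurations: $[\![\mathrm{Rejecting}]\!]$, $[\![\mathrm{Accepting}]\!]$, existential ones $[\![(\exists)\,\mathcal{A}\mid\{b;t\}]\!]$ and universal ones $[\![(\forall)\,\mathcal{A}\mid\{b;t\}\{b';t'\}]\!]$ with $b,b'\in\{yes,no\}$. Every term is uniquely of the form $N_0N_1\cdots N_p$ with $N_0$ a variable, an abstraction, an if-term or a constant. Transitions: ($\beta$) $[\![(\exists)\mathcal{A}\mid\{b;(\lambda x.N)N_1\cdots N_p\}]\!]\to[\![(\exists)\mathcal{A}@(x':=N_1)\mid\{b;N[x'/x]N_2\cdots N_p\}]\!]$ with $x'$ fresh; ($h$) $[\![(\exists)\mathcal{A}_1@(x:=N)@\mathcal{A}_2\mid\{b;x N_1\cdots N_p\}]\!]\to[\![(\exists)\mathcal{A}_1@(x:=N)@\mathcal{A}_2\mid\{b;N N_1\cdots N_p\}]\!]$; ($if$) $[\![(\exists)\mathcal{A}\mid\{b;(\mathrm{if}\ M_0\ \mathrm{then}\ M_1\ \mathrm{else}\ M_2)N_1\cdots N_p\}]\!]$ has the two successors $[\![(\forall)\mathcal{A}\mid\{yes;M_0\}\{b;M_1N_1\cdots N_p\}]\!]$ and $[\![(\forall)\mathcal{A}\mid\{no;M_0\}\{b;M_2N_1\cdots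 N_p\}]\!]$; ($if'$) $[\![(\forall)\mathcal{A}\mid\{a;M_0\}\{b;N\}]\!]$ has the two successors $[\![(\exists)\mathcal{A}\mid\{a;M_0\}]\!]$ and $[\![(\exists)\mathcal{A}\mid\{b;N\}]\!]$; base cases: $[\![(\exists)\mathcal{A}\mid\{yes;T\}]\!]$ and $[\![(\exists)\mathcal{A}\mid\{no;F\}]\!]$ go to $[\![\mathrm{Accepting}]\!]$, $[\![(\exists)\mathcal{A}\mid\{no;T\}]\!]$ and $[\![(\exists)\mathcal{A}\mid\{yes;F\}]\!]$ go to $[\![\mathrm{Rejecting}]\!]$. On input $M$ the initial configuration is $[\![(\exists)\emptyset\mid\{yes;M\}]\!]$; the computation is the tree of configurations so generated, and acceptance is as for alternating Turing machines (an existential configuration is accepted iff some successor is, a universal one iff all successors are). *)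

(* Defs.v *)
From Stdlib Require Export Arith List Permutation.
Export ListNotations.

(* Types and terms are taken up to renaming of bound variables, so both are
   represented locally nameless: free variables are names, bound variables are
   de Bruijn indices.  [TAll] and [Lam] are raw constructors; the mathematical
   binders are [ty_all] and [lam] below, which abstract a name. *)

Definition name := nat.

Inductive ty : Type :=
| TVar (a : name)
| TIdx (i : nat)
| TLin (A B : ty)
| TImp (A B : ty)
| TPar (A : ty)
| TAll (A : ty)
| TBool.

Definition pars (n : nat) (A : ty) : ty := Nat.iter n TPar A.

Fixpoint ty_open_at (k : nat) (B A : ty) : ty :=
  match A with
  | TVar a => TVar a
  | TIdx i => if Nat.eqb i k then B else TIdx i
  | TLin A1 A2 => TLin (ty_open_at k B A1) (ty_open_at k B A2)
  | TImp A1 A2 => TImp (ty_open_at k B A1) (ty_open_at k B A2)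
  | TPar A1 => TPar (ty_open_at k B A1)
  | TAll A1 => TAll (ty_open_at (S k) B A1)
  | TBool => TBool
  end.

(* [ty_inst A B] is A'[B/a] when [TAll A] stands for "forall a, A'". *)
Definition ty_inst (A B : ty) : ty := ty_open_at 0 B A.

Fixpoint ty_close_at (k : nat) (a : name) (A : ty) : ty :=
  match A with
  | TVar b => if Nat.eqb a b then TIdx k else TVar b
  | TIdx i => TIdx i
  | TLin A1 A2 => TLin (ty_close_at k a A1) (ty_close_at k a A2)
  | TImp A1 A2 => TImp (ty_close_at k a A1) (ty_close_at k a A2)
  | TPar A1 => TPar (ty_close_at k a A1)
  | TAll A1 => TAll (ty_close_at (S k) a A1)
  | TBool => TBool
  end.

Definition ty_all (a : name) (A : ty) : ty := TAll (ty_close_at 0 a A).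

Fixpoint ftv (A : ty) : list name :=
  match A with
  | TVar a => [a]
  | TIdx _ => []
  | TLin A1 A2 => ftv A1 ++ ftv A2
  | TImp A1 A2 => ftv A1 ++ ftv A2
  | TPar A1 => ftv A1
  | TAll A1 => ftv A1
  | TBool => []
  end.

Fixpoint lc_ty_at (k : nat) (A : ty) : Prop :=
  match A with
  | TVar _ => True
  | TIdx i => i < k
  | TLin A1 A2 => lc_ty_at k A1 /\ lc_ty_at k A2
  | TImp A1 A2 => lc_ty_at k A1 /\ lc_ty_at k A2
  | TPar A1 => lc_ty_at k A1
  | TAll A1 => lc_ty_at (S k) A1
  | TBool => True
  end.

(* No dangling index: [A] represents an actual type. *)
Definition lc_ty (A : ty) : Prop := lc_ty_at 0 A.

Inductive term : Type :=
| Var (x : name)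
| Idx (i : nat)
| FF
| TT
| Lam (t : term)
| App (t u : term)
| If (t u v : term).

Fixpoint size (t : term) : nat :=
  match t with
  | Var _ => 1
  | Idx _ => 1
  | FF => 1
  | TT => 1
  | Lam t => size t + 1
  | App t u => size t + size u + 1
  | If t u v => size t + size u + size v + 1
  end.

Fixpoint open_at (k : nat) (u t : term) : term :=
  match t with
  | Var x => Var x
  | Idx i => if Nat.eqb i k then u else Idx i
  | FF => FF
  | TT => TT
  | Lam t => Lam (open_at (S k) u t)
  | App t1 t2 => App (open_at k u t1) (open_at k u t2)
  | If t1 t2 t3 => If (open_at k u t1) (open_at k u t2) (open_at k u t3)
  end.

(* [inst t y] is N[y/x] when [Lam t] stands for "lambda x, N". *)
Definition inst (t : term) (y : name) : term := open_at 0 (Var y) t.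

Fixpoint close_at (k : nat) (x : name) (t : term) : term :=
  match t with
  | Var y => if Nat.eqb x y then Idx k else Var y
  | Idx i => Idx i
  | FF => FF
  | TT => TT
  | Lam t => Lam (close_at (S k) x t)
  | App t1 t2 => App (close_at k x t1) (close_at k x t2)
  | If t1 t2 t3 => If (close_at k x t1) (close_at k x t2) (close_at k x t3)
  end.

Definition lam (x : name) (t : term) : term := Lam (close_at 0 x t).

Fixpoint fv (t : term) : list name :=
  match t with
  | Var x => [x]
  | Idx _ => []
  | FF => []
  | TT => []
  | Lam t => fv t
  | App t u => fv t ++ fv u
  | If t u v => fv t ++ fv u ++ fv v
  end.

(* [subst x u t] is t[u/x]; it is only used with [u] free of dangling indices,
   so no capture can occur. *)
Fixpoint subst (x : name) (u t : term) : term :=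
  match t with
  | Var y => if Nat.eqb x y then u else Var y
  | Idx i => Idx i
  | FF => FF
  | TT => TT
  | Lam t => Lam (subst x u t)
  | App t1 t2 => App (subst x u t1) (subst x u t2)
  | If t1 t2 t3 => If (subst x u t1) (subst x u t2) (subst x u t3)
  end.

Definition ctx := list (name * ty).

Definition dom (G : ctx) : list name := map fst G.

Definition ctx_par (D : ctx) : ctx := map (fun p => (fst p, TPar (snd p))) D.

Definition wf_ctxs (G D : ctx) : Prop :=
  NoDup (dom (G ++ D)) /\ Forall (fun p => lc_ty (snd p)) (G ++ D).

(* [deriv G D t A] is the type of derivations of G ; D |- t : A.
   Contexts are unordered: they are lists, and [d_exch] identifies lists that
   are permutations of each other.  Every rule that creates or merges contexts
   requires its conclusion to be well formed, so all derivable judgements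
   satisfy [wf_ctxs].  In [d_cntr] the sequential substitution agrees with the
   simultaneous one because both replace by the same variable [x]. *)
Inductive deriv : ctx -> ctx -> term -> ty -> Type :=
| d_exch G D G' D' t A :
    Permutation G G' -> Permutation D D' ->
    deriv G D t A ->
    deriv G' D' t A
| d_id x A :
    lc_ty A ->
    deriv [] [(x, A)] (Var x) A
| d_lin_i G D x A t B :
    deriv G ((x, A) :: D) t B ->
    deriv G D (lam x t) (TLin A B)
| d_lin_e G1 G2 D1 D2 t u A B :
    wf_ctxs (G1 ++ G2) (D1 ++ D2) ->
    deriv G1 D1 t (TLin A B) ->
    deriv G2 D2 u A ->
    deriv (G1 ++ G2) (D1 ++ D2) (App t u) B
| d_imp_i G D x A t B :
    deriv ((x, A) :: G) D t B ->
    deriv G D (lam x t) (TImp A B)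
| d_imp_e G D z C t u A B :
    wf_ctxs ((z, C) :: G) D ->
    deriv G D t (TImp A B) ->
    deriv [] [(z, C)] u A ->
    deriv ((z, C) :: G) D (App t u) B
| d_imp_e0 G D t u A B :
    deriv G D t (TImp A B) ->
    deriv [] [] u A ->
    deriv G D (App t u) B
| d_weak G1 G2 D1 D2 t A :
    wf_ctxs (G1 ++ G2) (D1 ++ D2) ->
    deriv G1 D1 t A ->
    deriv (G1 ++ G2) (D1 ++ D2) t A
| d_cntr G D x x1 x2 A t B :
    wf_ctxs ((x, A) :: G) D ->
    deriv ((x1, A) :: (x2, A) :: G) D t B ->
    deriv ((x, A) :: G) D (subst x2 (Var x) (subst x1 (Var x) t)) B
| d_par_i G D t A :
    deriv [] (G ++ D) t A ->
    deriv G (ctx_par D) t (TPar A)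
| d_par_e G1 G2 D1 D2 x t u A B :
    wf_ctxs (G1 ++ G2) (D1 ++ D2) ->
    deriv G1 D1 u (TPar A) ->
    deriv G2 ((x, TPar A) :: D2) t B ->
    deriv (G1 ++ G2) (D1 ++ D2) (subst x u t) B
| d_all_i G D t a A :
    Forall (fun p => ~ In a (ftv (snd p))) (G ++ D) ->
    deriv G D t A ->
    deriv G D t (ty_all a A)
| d_all_e G D t A B :
    lc_ty B ->
    deriv G D t (TAll A) ->
    deriv G D t (ty_inst A B)
| d_bool0_i :
    deriv [] [] FF TBool
| d_bool1_i :
    deriv [] [] TT TBool
| d_bool_e G D k M0 M1 M2 A :
    deriv G D M0 (pars k TBool) ->
    deriv G D M1 A ->
    deriv G D M2 A ->
    deriv G D (If M0 M1 M2) A.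

Fixpoint depth {G D : ctx} {t : term} {A : ty} (d : deriv G D t A) : nat :=
  match d with
  | d_exch _ _ _ _ _ _ _ _ d1 => depth d1
  | d_id _ _ _ => 0
  | d_lin_i _ _ _ _ _ _ d1 => depth d1
  | d_lin_e _ _ _ _ _ _ _ _ _ d1 d2 => Nat.max (depth d1) (depth d2)
  | d_imp_i _ _ _ _ _ _ d1 => depth d1
  | d_imp_e _ _ _ _ _ _ _ _ _ d1 d2 => Nat.max (depth d1) (S (depth d2))
  | d_imp_e0 _ _ _ _ _ _ d1 d2 => Nat.max (depth d1) (S (depth d2))
  | d_weak _ _ _ _ _ _ _ d1 => depth d1
  | d_cntr _ _ _ _ _ _ _ _ _ d1 => depth d1
  | d_par_i _ _ _ _ d1 => S (depth d1)
  | d_par_e _ _ _ _ _ _ _ _ _ _ d1 d2 => Nat.max (depth d1) (depth d2)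
  | d_all_i _ _ _ _ _ _ d1 => depth d1
  | d_all_e _ _ _ _ _ _ d1 => depth d1
  | d_bool0_i => 0
  | d_bool1_i => 0
  | d_bool_e _ _ _ _ _ _ _ d0 d1 d2 =>
      Nat.max (depth d0) (Nat.max (depth d1) (depth d2))
  end.

Definition env := list (name * term).

Definition env_vars (E : env) : list name :=
  flat_map (fun p => fst p :: fv (snd p)) E.

Inductive answer : Type := yes | no.

Inductive config : Type :=
| Rejecting
| Accepting
| CEx (E : env) (b : answer) (t : term)
| CAll (E : env) (b : answer) (t : term) (b' : answer) (t' : term).

Definition apps (t : term) (us : list term) : term := fold_left App us t.

(* [step c c'] : c' is a successor of c.  The names assigned in an environment
   are distinct in every configuration reachable from an initial one, since
   [s_beta] is the only rule that extends it and the added name is fresh. *)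
Inductive step : config -> config -> Prop :=
| s_beta E b N N1 Ns x' :
    ~ In x' (env_vars E) ->
    ~ In x' (fv (apps (Lam N) (N1 :: Ns))) ->
    step (CEx E b (apps (Lam N) (N1 :: Ns)))
         (CEx (E ++ [(x', N1)]) b (apps (inst N x') Ns))
| s_head E1 E2 x N b Ns :
    step (CEx (E1 ++ [(x, N)] ++ E2) b (apps (Var x) Ns))
         (CEx (E1 ++ [(x, N)] ++ E2) b (apps N Ns))
| s_if_yes E b M0 M1 M2 Ns :
    step (CEx E b (apps (If M0 M1 M2) Ns))
         (CAll E yes M0 b (apps M1 Ns))
| s_if_no E b M0 M1 M2 Ns :
    step (CEx E b (apps (If M0 M1 M2) Ns))
         (CAll E no M0 b (apps M2 Ns))
| s_all_l E a M0 b N :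
    step (CAll E a M0 b N) (CEx E a M0)
| s_all_r E a M0 b N :
    step (CAll E a M0 b N) (CEx E b N)
| s_yes_T E : step (CEx E yes TT) Accepting
| s_no_F E : step (CEx E no FF) Accepting
| s_no_T E : step (CEx E no TT) Rejecting
| s_yes_F E : step (CEx E yes FF) Rejecting.

Definition init (M : term) : config := CEx [] yes M.

(* [path l c c'] : a path of l transitions from c to c'. *)
Inductive path : nat -> config -> config -> Prop :=
| path_nil c : path 0 c c
| path_cons l c1 c2 c3 : step c1 c2 -> path l c2 c3 -> path (S l) c1 c3.

(* Main.v *)
From Stdlib Require Import Lia.
Require Import Defs.

(* Every abstraction and application of [M] is annotated either as linear or as
   non-linear of level [i], the level being the number of premises of (§i) and
   arguments of (=>e) crossed on the way down the derivation; § itself becomes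
   invisible.  A Krivine realizability model shows that an abstraction only ever
   meets an application with the same annotation, so no subject reduction is
   needed.

   An argument of level [i] has at most one free variable, which it uses
   linearly and which is bound at level [i], and contains only levels above [i].
   Weak head reduction substitutes closed terms only, so an open argument is
   never modified before it gets closed, and closed arguments of level [i] are
   chains of open ones whose length is bounded by the number of beta steps of
   level [i].  With [m] the size of [M] this bounds the copies of an argument of
   level [i], counted at level [k], by [m ^ (3 * 2^k - 3 * 2^i)], and yields a
   potential decreasing at each beta or conditional step, initially at most
   [m ^ (3 * 2^(d+1) - 2)].  Since linear variables may occur in all three parts
   of a conditional, of which a path explores only one, sizes and occurrences
   are maximised over these parts.

   A configuration of the machine expands, by performing the substitutions of
   its environment, to a term of this calculus; head steps leave the expansion
   unchanged but move down in the environment, whose length is the number of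
   beta steps made so far. *)

(** * Annotated terms *)

Inductive mode : Type := Lin | Non (i : nat).

Inductive var : Type := Free (x : name) | Bnd (i : nat).

Inductive aterm : Type :=
| AVar (y : var)
| ACst (b : bool)
| ALam (m : mode) (t : aterm)
| AApp (m : mode) (t u : aterm)
| AIf (t u v : aterm).

Fixpoint erase (t : aterm) : term :=
  match t with
  | AVar (Free x) => Var x
  | AVar (Bnd i) => Idx i
  | ACst true => TT
  | ACst false => FF
  | ALam _ t => Lam (erase t)
  | AApp _ t u => App (erase t) (erase u)
  | AIf t u v => If (erase t) (erase u) (erase v)
  end.

Lemma var_eq_dec (y z : var) : {y = z} + {y <> z}.
Proof. decide equality; apply Nat.eq_dec. Qed.

Lemma mode_eq_dec (a b : mode) : {a = b} + {a <> b}.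
Proof. decide equality; apply Nat.eq_dec. Qed.

Definition upd {T : Type} (f : var -> T) (y : var) (a : T) : var -> T :=
  fun z => if var_eq_dec y z then a else f z.

Definition up (y : var) : var :=
  match y with Free x => Free x | Bnd i => Bnd (S i) end.

Definition push {T : Type} (a : T) (f : var -> T) : var -> T :=
  fun z => match z with
           | Free x => f (Free x)
           | Bnd 0 => a
           | Bnd (S i) => f (Bnd i)
           end.

Lemma push_up {T : Type} (a : T) (f : var -> T) y : push a f (up y) = f y.
Proof. destruct y; reflexivity. Qed.

(** Together with [push_up] and [up_neq0] this replaces arithmetic on indices in the inductions
    below that cross a binder. *)
Lemma var_cases (z : var) : z = Bnd 0 \/ exists y, z = up y.
Proof.
  destruct z as [x|[|i]]; [right; exists (Free x)|left|right; exists (Bnd i)];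
    reflexivity.
Qed.

Lemma up_inj y z : up y = up z -> y = z.
Proof. destruct y, z; simpl; congruence. Qed.

Lemma up_neq0 y : up y <> Bnd 0.
Proof. destruct y; discriminate. Qed.

Lemma upd_same {T : Type} (f : var -> T) y a : upd f y a y = a.
Proof. unfold upd; destruct (var_eq_dec y y); congruence. Qed.

Lemma upd_other {T : Type} (f : var -> T) y a z : y <> z -> upd f y a z = f z.
Proof. unfold upd; destruct (var_eq_dec y z); congruence. Qed.

Lemma push_upd {T : Type} (a b : T) f y z :
  push a (upd f y b) z = upd (push a f) (up y) b z.
Proof.
  destruct (var_cases z) as [->|[w ->]].
  - rewrite upd_other by apply up_neq0. reflexivity.
  - rewrite push_up. destruct (var_eq_dec y w) as [->|n].
    + now rewrite !upd_same.
    + rewrite !upd_other; [now rewrite push_up| |assumption].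
      intro e; apply n, up_inj, e.
Qed.

(* [u] is expected to have no dangling index, so it is not lifted. *)
Fixpoint sub (y : var) (u t : aterm) : aterm :=
  match t with
  | AVar z => if var_eq_dec y z then u else AVar z
  | ACst b => ACst b
  | ALam m t => ALam m (sub (up y) u t)
  | AApp m t1 t2 => AApp m (sub y u t1) (sub y u t2)
  | AIf t1 t2 t3 => AIf (sub y u t1) (sub y u t2) (sub y u t3)
  end.

(** Unlike the term inserted by [sub], the new variable is lifted under binders, because closing a
    body renames a name to a bound index. *)
Fixpoint ren (y z : var) (t : aterm) : aterm :=
  match t with
  | AVar w => if var_eq_dec y w then AVar z else AVar w
  | ACst b => ACst b
  | ALam m t => ALam m (ren (up y) (up z) t)
  | AApp m t1 t2 => AApp m (ren y z t1) (ren y z t2)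
  | AIf t1 t2 t3 => AIf (ren y z t1) (ren y z t2) (ren y z t3)
  end.

Fixpoint msub (g : name -> aterm) (t : aterm) : aterm :=
  match t with
  | AVar (Free x) => g x
  | AVar (Bnd i) => AVar (Bnd i)
  | ACst b => ACst b
  | ALam m t => ALam m (msub g t)
  | AApp m t1 t2 => AApp m (msub g t1) (msub g t2)
  | AIf t1 t2 t3 => AIf (msub g t1) (msub g t2) (msub g t3)
  end.

Fixpoint lcat (k : nat) (t : aterm) : Prop :=
  match t with
  | AVar (Free _) => True
  | AVar (Bnd i) => i < k
  | ACst _ => True
  | ALam _ t => lcat (S k) t
  | AApp _ t u => lcat k t /\ lcat k u
  | AIf t u v => lcat k t /\ lcat k u /\ lcat k v
  end.

Lemma erase_sub_free x u t :
  erase (sub (Free x) u t) = subst x (erase u) (erase t).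
Proof.
  induction t as [[y|i]|[]| | |]; simpl; try congruence; try reflexivity.
  - destruct (var_eq_dec (Free x) (Free y)) as [e|n].
    + injection e as e. subst y. now rewrite Nat.eqb_refl.
    + destruct (Nat.eqb_spec x y); [congruence|reflexivity].
  - destruct (var_eq_dec (Free x) (Bnd i)); [discriminate|reflexivity].
Qed.

Lemma erase_sub_bnd k u t :
  erase (sub (Bnd k) u t) = open_at k (erase u) (erase t).
Proof.
  revert k; induction t as [[y|i]|[]| | |]; intro k; simpl;
    try congruence; try reflexivity.
  - destruct (var_eq_dec (Bnd k) (Free y)); [discriminate|reflexivity].
  - destruct (var_eq_dec (Bnd k) (Bnd i)) as [e|n].
    + injection e as ->. now rewrite Nat.eqb_refl.
    + destruct (Nat.eqb_spec i k); [congruence|reflexivity].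
Qed.

Lemma erase_ren_free x z t :
  erase (ren (Free x) (Free z) t) = subst x (Var z) (erase t).
Proof.
  induction t as [[y|i]|[]| | |]; simpl; try congruence; try reflexivity.
  - destruct (var_eq_dec (Free x) (Free y)) as [e|n].
    + injection e as e. subst y. now rewrite Nat.eqb_refl.
    + destruct (Nat.eqb_spec x y); [congruence|reflexivity].
  - destruct (var_eq_dec (Free x) (Bnd i)); [discriminate|reflexivity].
Qed.

Lemma erase_ren_close x k t :
  erase (ren (Free x) (Bnd k) t) = close_at k x (erase t).
Proof.
  revert k; induction t as [[y|i]|[]| | |]; intro k; simpl;
    try congruence; try reflexivity.
  - destruct (var_eq_dec (Free x) (Free y)) as [e|n].
    + injection e as e. subst y. now rewrite Nat.eqb_refl.
    + destruct (Nat.eqb_spec x y); [congruence|reflexivity].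
  - destruct (var_eq_dec (Free x) (Bnd i)); [discriminate|reflexivity].
Qed.

Lemma lcat_le k k' t : k <= k' -> lcat k t -> lcat k' t.
Proof.
  revert k k'; induction t as [[y|i]| |m t IH| |]; intros k k' h; simpl;
    try tauto; try lia.
  - apply IH; lia.
  - firstorder.
  - firstorder.
Qed.

Lemma sub_lcat k i u t : lcat k t -> k <= i -> sub (Bnd i) u t = t.
Proof.
  revert k i; induction t as [[y|j]| | | |]; intros k i h hk; simpl in *.
  - destruct (var_eq_dec (Bnd i) (Free y)); [discriminate|reflexivity].
  - destruct (var_eq_dec (Bnd i) (Bnd j)) as [e|]; [|reflexivity].
    injection e; lia.
  - reflexivity.
  - f_equal. apply IHt with (S k); [assumption|lia].
  - f_equal; [apply IHt1 with k|apply IHt2 with k]; tauto.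
  - f_equal; [apply IHt1 with k|apply IHt2 with k|apply IHt3 with k]; tauto.
Qed.

Lemma lcat_msub g k t :
  (forall x, lcat 0 (g x)) -> lcat k t -> lcat k (msub g t).
Proof.
  intro hg; revert k; induction t as [[y|j]| | | |]; intros k h; simpl in *;
    firstorder.
  apply lcat_le with 0; [lia|apply hg].
Qed.

Definition updn (g : name -> aterm) (x : name) (u : aterm) : name -> aterm :=
  fun y => if Nat.eqb x y then u else g y.

Lemma updn_same g x u : updn g x u x = u.
Proof. unfold updn; now rewrite Nat.eqb_refl. Qed.

Lemma updn_other g x u y : x <> y -> updn g x u y = g y.
Proof. unfold updn; destruct (Nat.eqb_spec x y); congruence. Qed.

(** The beta step of the realizability model: binding a name and then contracting amounts to
    extending [g] at that name. The closure hypotheses ensure that opening at [k] hits only the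
    former occurrences of [x]. *)
Lemma open_msub_close g x u k t :
  (forall y, lcat 0 (g y)) -> lcat k t ->
  sub (Bnd k) u (msub g (ren (Free x) (Bnd k) t)) = msub (updn g x u) t.
Proof.
  intro hg; revert k; induction t as [[y|j]| | | |]; intros k h; simpl in *.
  - destruct (var_eq_dec (Free x) (Free y)) as [e|n]; simpl.
    + injection e as ->. rewrite updn_same.
      destruct (var_eq_dec (Bnd k) (Bnd k)); congruence.
    + rewrite updn_other by congruence. apply sub_lcat with 0; [apply hg|lia].
  - destruct (var_eq_dec (Free x) (Bnd j)); [discriminate|]. simpl.
    destruct (var_eq_dec (Bnd k) (Bnd j)) as [e|]; [|reflexivity].
    injection e; lia.
  - reflexivity.
  - f_equal; auto.
  - f_equal; firstorder.
  - f_equal; firstorder.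
Qed.

Lemma msub_sub g x u t :
  msub g (sub (Free x) u t) = msub (updn g x (msub g u)) t.
Proof.
  induction t as [[y|j]| | | |]; simpl; try congruence.
  - destruct (var_eq_dec (Free x) (Free y)) as [e|n].
    + injection e as ->. now rewrite updn_same.
    + now rewrite updn_other by congruence.
  - destruct (var_eq_dec (Free x) (Bnd j)); [discriminate|reflexivity].
Qed.

Lemma msub_ren g x z t :
  msub g (ren (Free x) (Free z) t) = msub (updn g x (g z)) t.
Proof.
  induction t as [[y|j]| | | |]; simpl; try congruence.
  - destruct (var_eq_dec (Free x) (Free y)) as [e|n].
    + injection e as ->. now rewrite updn_same.
    + now rewrite updn_other by congruence.
  - destruct (var_eq_dec (Free x) (Bnd j)); [discriminate|reflexivity].
Qed.

Lemma msub_id t : msub (fun x => AVar (Free x)) t = t.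
Proof. induction t as [[y|j]| | | |]; simpl; congruence. Qed.

Fixpoint all_levels (P : nat -> Prop) (t : aterm) : Prop :=
  let ok m := match m with Lin => True | Non i => P i end in
  match t with
  | AVar _ => True
  | ACst _ => True
  | ALam m t => ok m /\ all_levels P t
  | AApp m t u => ok m /\ all_levels P t /\ all_levels P u
  | AIf t u v => all_levels P t /\ all_levels P u /\ all_levels P v
  end.

Lemma all_levels_impl (P Q : nat -> Prop) t :
  (forall i, P i -> Q i) -> all_levels P t -> all_levels Q t.
Proof.
  intro h; induction t as [| |[] t IH|[] t1 IH1 t2 IH2|]; simpl; intuition.
Qed.

Lemma all_levels_sub P y u t :
  all_levels P t -> all_levels P u -> all_levels P (sub y u t).
Proof.
  intros ht hu; revert y ht; induction t; intro z; simpl; intuition.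
  destruct (var_eq_dec z y); simpl; auto.
Qed.

Lemma all_levels_ren P y z t : all_levels P t -> all_levels P (ren y z t).
Proof.
  revert y z; induction t; intros w z; simpl; intuition.
  destruct (var_eq_dec w y); exact I.
Qed.

(** * Weights of annotated terms under a valuation of their variables *)

Section Weight.

Variables (wl : mode -> nat) (wn : nat) (kap : mode -> nat).

(* Branches of a conditional are alternatives, hence the maximum; the argument
   of a non-linear application is accounted for by [kap], the anticipated
   weight of whatever gets substituted for an occurrence of the variable. *)
Fixpoint weight (v : var -> nat) (t : aterm) : nat :=
  match t with
  | AVar y => v y
  | ACst _ => wn
  | ALam m t => wl m + weight (push (kap m) v) t
  | AApp Lin t u => wn + weight v t + weight v u
  | AApp (Non _) t u => wn + weight v t
  | AIf t u w => wn + Nat.max (weight v t) (Nat.max (weight v u) (weight v w))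
  end.

Lemma weight_mono v v' t :
  (forall y, v y <= v' y) -> weight v t <= weight v' t.
Proof.
  revert v v'; induction t as [|b|m t IH|[|i] t IHt u IHu|t IHt u IHu w IHw];
    intros v v' h; simpl.
  - apply h.
  - lia.
  - apply Nat.add_le_mono_l, IH. intro y.
    destruct (var_cases y) as [->|[z ->]]; [reflexivity|].
    rewrite !push_up; apply h.
  - specialize (IHt _ _ h); specialize (IHu _ _ h); lia.
  - specialize (IHt _ _ h); lia.
  - specialize (IHt _ _ h); specialize (IHu _ _ h); specialize (IHw _ _ h); lia.
Qed.

Lemma weight_ext v v' t : (forall y, v y = v' y) -> weight v t = weight v' t.
Proof.
  intro h; apply Nat.le_antisymm; apply weight_mono; intro y; rewrite h; lia.
Qed.

Lemma weight_ren v y z t :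
  weight v (ren y z t) = weight (upd v y (v z)) t.
Proof.
  revert v y z; induction t as [x|b|m t IH|[|i] t IHt u IHu|]; intros v y z; simpl.
  - destruct (var_eq_dec y x) as [->|n].
    + now rewrite upd_same.
    + now rewrite upd_other.
  - reflexivity.
  - rewrite IH. f_equal. apply weight_ext; intro w.
    now rewrite push_upd, push_up.
  - now rewrite IHt, IHu.
  - now rewrite IHt.
  - now rewrite IHt1, IHt2, IHt3.
Qed.

(** Each variable, free or bound, weighs at most [B] and every other node at most 1, hence at most
    [B]; a maximum is at most the sum. *)
Lemma weight_bound (P : nat -> Prop) B v t :
  1 <= B -> wn <= 1 -> (forall m, wl m <= 1) -> kap Lin <= B ->
  (forall i, P i -> kap (Non i) <= B) ->
  all_levels P t -> (forall y, v y <= B) ->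
  weight v t <= size (erase t) * B.
Proof.
  intros hB hn hl hL hN.
  revert v; induction t as [[y|j]|[]|m t IH|m t IHt u IHu|t IHt u IHu w IHw];
    intros v ht hv; simpl in *.
  - rewrite Nat.add_0_r; apply hv.
  - rewrite Nat.add_0_r; apply hv.
  - lia.
  - lia.
  - specialize (hl m). destruct ht as [hm ht].
    assert (h : weight (push (kap m) v) t <= size (erase t) * B).
    { apply IH; [assumption|]. intro y. destruct (var_cases y) as [->|[z ->]].
      - simpl. destruct m; auto.
      - rewrite push_up; apply hv. }
    lia.
  - destruct ht as (hm & ht & hu).
    specialize (IHt _ ht hv); specialize (IHu _ hu hv). destruct m; lia.
  - destruct ht as (ht & hu & hw).
    specialize (IHt _ ht hv); specialize (IHu _ hu hv); specialize (IHw _ hw hv).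
    nia.
Qed.

End Weight.

(** * Occurrence counts *)

Definition ind (y : var) : var -> nat := upd (fun _ => 0) y 1.

Lemma ind_same y : ind y y = 1.
Proof. apply upd_same. Qed.

Lemma ind_other y z : y <> z -> ind y z = 0.
Proof. apply upd_other. Qed.

Definition occ (v : var -> nat) (t : aterm) : nat :=
  weight (fun _ => 0) 0 (fun _ => 0) v t.

(* On a term where [y] does not occur inside non-linear arguments. *)
Definition count (y : var) (t : aterm) : nat := occ (ind y) t.

(** The weight is affine in the valuation except at conditionals, where a maximum of sums is at most
    the sum of the maxima; hence an inequality. *)
Lemma weight_add wl wn kap c o v v' t :
  (forall y, v y <= v' y + c * o y) ->
  weight wl wn kap v t <= weight wl wn kap v' t + c * occ o t.
Proof.
  unfold occ; revert o v v';
    induction t as [|b|m t IH|[|i] t IHt u IHu|t IHt u IHu w IHw];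
    intros o v v' h; simpl.
  - apply h.
  - lia.
  - rewrite <- Nat.add_assoc. apply Nat.add_le_mono_l, IH. intro y.
    destruct (var_cases y) as [->|[z ->]]; [simpl; lia|].
    rewrite !push_up; apply h.
  - specialize (IHt _ _ _ h); specialize (IHu _ _ _ h); lia.
  - specialize (IHt _ _ _ h); lia.
  - specialize (IHt _ _ _ h); specialize (IHu _ _ _ h); specialize (IHw _ _ _ h).
    nia.
Qed.

Lemma occ_zero v t : (forall y, v y = 0) -> occ v t = 0.
Proof.
  unfold occ; revert v.
  induction t as [x|b|m t IH|[|i] t IHt w IHw|]; intros v hv; simpl; auto.
  - apply IH. intro z. destruct (var_cases z) as [->|[w ->]]; auto.
    rewrite push_up; auto.
  - now rewrite IHt, IHw.
  - now rewrite IHt1, IHt2, IHt3.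
Qed.

(** * Well-formedness relative to the kinds of variables *)

Definition kinds := var -> option mode.

Definition none : kinds := fun _ => None.

Definition only (y : var) : kinds := upd none y (Some Lin).

Section WF.

Variables (Pc Po : nat -> aterm -> Prop).

(* A linear variable never occurs inside a non-linear argument; a non-linear
   argument [u] of level [i] has at most one free variable, used linearly in [u]
   and bound at the same level [i]. [Pc] and [Po] are extra requirements on
   non-linear arguments without (resp. with) a free variable. *)
Inductive wf : kinds -> aterm -> Prop :=
| wf_var K y m : K y = Some m -> wf K (AVar y)
| wf_cst K b : wf K (ACst b)
| wf_lam K m t :
    wf (push (Some m) K) t -> (m = Lin -> count (Bnd 0) t <= 1) ->
    wf K (ALam m t)
| wf_app_lin K t u : wf K t -> wf K u -> wf K (AApp Lin t u)
| wf_app_closed K i t u :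
    wf K t -> wf none u -> all_levels (lt i) u -> Pc i u ->
    wf K (AApp (Non i) t u)
| wf_app_open K i y t u :
    wf K t -> K y = Some (Non i) -> wf (only y) u -> count y u <= 1 ->
    all_levels (lt i) u -> Po i u ->
    wf K (AApp (Non i) t u)
| wf_if K t u w : wf K t -> wf K u -> wf K w -> wf K (AIf t u w).

Definition no_bnd (K : kinds) : Prop := forall i, K (Bnd i) = None.

Lemma no_bnd_none : no_bnd none.
Proof. intro; reflexivity. Qed.

(** A variable of kind [None] does not occur in [t], so its value is irrelevant. *)
Lemma weight_wf wl wn kap K t :
  wf K t -> forall v v', (forall y, K y <> None -> v y = v' y) ->
  weight wl wn kap v t = weight wl wn kap v' t.
Proof.
  induction 1; intros v v' h; simpl; auto.
  - apply h; congruence.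
  - f_equal; apply IHwf. intro y. destruct (var_cases y) as [->|[z ->]]; auto.
    rewrite !push_up; apply h.
Qed.

Lemma wf_lcat K t k :
  wf K t -> (forall i, k <= i -> K (Bnd i) = None) -> lcat k t.
Proof.
  intro h; revert k.
  induction h as [K [x|i] m e| |K m t _ IH _| |K i t u _ IHt _ IHu _ _
    |K i y t u _ IHt e _ IHu _ _ _ |]; intros k hk; simpl; auto.
  - destruct (Nat.lt_ge_cases i k) as [|l]; [assumption|].
    rewrite (hk _ l) in e; discriminate.
  - apply IH. intros [|i] l; [lia|]. apply hk; lia.
  - split; [auto|]. apply IHu. intros j l. unfold only.
    rewrite upd_other; [reflexivity|]. intros ->. now rewrite (hk _ l) in e.
Qed.

(** Exact although [u] may also enter non-linear arguments, since [weight] skips them. Under a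
    binder the weight of [u] ignores the pushed value, as [u] has no bound variable. *)
Lemma weight_sub wl wn kap K y u v t :
  wf K u -> no_bnd K ->
  weight wl wn kap v (sub y u t) =
  weight wl wn kap (upd v y (weight wl wn kap v u)) t.
Proof.
  intros hu hK; revert v y.
  induction t as [x|b|m t IH|[|i] t IHt w IHw|]; intros v y; simpl.
  - destruct (var_eq_dec y x) as [->|n].
    + now rewrite upd_same.
    + now rewrite upd_other.
  - reflexivity.
  - rewrite IH. f_equal. apply weight_ext; intro w. rewrite push_upd.
    unfold upd. destruct (var_eq_dec (up y) w); [|reflexivity].
    eapply weight_wf; [exact hu|]. intros [x|i] hx; [reflexivity|].
    now rewrite hK in hx.
  - now rewrite IHt, IHw.
  - now rewrite IHt.
  - now rewrite IHt1, IHt2, IHt3.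
Qed.

Lemma count_none K y t : wf K t -> K y = None -> count y t = 0.
Proof.
  intros h hy. unfold count, occ.
  rewrite (weight_wf _ _ _ _ _ h _ (fun _ => 0)); [now apply occ_zero|].
  intros z hz. unfold ind. apply upd_other. congruence.
Qed.

Lemma sub_none K y u t : wf K t -> K y = None -> sub y u t = t.
Proof.
  intro h; revert y. induction h; intros z hz; simpl; f_equal; auto.
  - destruct (var_eq_dec z y); congruence.
  - apply IHh. now rewrite push_up.
  - apply IHh2. unfold only. rewrite upd_other; [reflexivity|congruence].
Qed.

Lemma ren_none K y z t : wf K t -> K y = None -> ren y z t = t.
Proof.
  intro h; revert y z. induction h; intros a z hz; simpl; f_equal; auto.
  - destruct (var_eq_dec a y); congruence.
  - apply IHh. now rewrite push_up.
  - apply IHh2. unfold only. rewrite upd_other; [reflexivity|congruence].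
Qed.

(** A linear variable may become non-linear, as the introduction of § requires; a non-linear one
    keeps its level, on which the open arguments containing it depend. *)
Definition kinds_le (K K' : kinds) : Prop :=
  forall y, match K y with
            | None => True
            | Some Lin => K' y <> None
            | Some (Non i) => K' y = Some (Non i)
            end.

Lemma kinds_le_push m K K' : kinds_le K K' -> kinds_le (push m K) (push m K').
Proof.
  intros h y. destruct (var_cases y) as [->|[z ->]].
  - simpl. destruct m as [[]|]; easy.
  - rewrite !push_up. apply h.
Qed.

End WF.

Lemma wf_impl (Pc Po Pc' Po' : nat -> aterm -> Prop) K K' t :
  (forall i u, Pc i u -> Pc' i u) -> (forall i u, Po i u -> Po' i u) ->
  kinds_le K K' -> wf Pc Po K t -> wf Pc' Po' K' t.
Proof.
  intros hc ho hK h; revert K' hK.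
  assert (R : forall K, kinds_le K K).
  { intros K0 y; destruct (K0 y) as [[]|]; easy. }
  induction h; intros K' hK.
  - specialize (hK y). rewrite H in hK.
    destruct m; [|now apply wf_var with (Non i)].
    destruct (K' y) eqn:e; [now apply wf_var with m|congruence].
  - constructor.
  - constructor; [|assumption]. now apply IHh, kinds_le_push.
  - constructor; auto.
  - apply wf_app_closed; auto.
  - apply wf_app_open with y; auto.
    specialize (hK y). now rewrite H in hK.
  - constructor; auto.
Qed.

Lemma wf_kinds Pc Po K K' t : kinds_le K K' -> wf Pc Po K t -> wf Pc Po K' t.
Proof. apply wf_impl; auto. Qed.

Lemma ind_push y z : push 0 (ind y) z = ind (up y) z.
Proof.
  unfold ind; rewrite push_upd. unfold upd.
  destruct (var_eq_dec (up y) z); [reflexivity|].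
  destruct z as [|[]]; reflexivity.
Qed.

Lemma count_sub Pc Po K z y u t :
  wf Pc Po K u -> no_bnd K ->
  count z (sub y u t) <= count z t + count z u * count y t.
Proof.
  intros hu hK. unfold count, occ. rewrite (weight_sub Pc Po _ _ _ K); auto.
  apply weight_add. intro w. destruct (var_eq_dec y w) as [<-|n'].
  - rewrite upd_same. unfold ind at 4. rewrite upd_same. lia.
  - rewrite upd_other by assumption. lia.
Qed.

Lemma count_sub_same Pc Po K y u t :
  wf Pc Po K u -> no_bnd K -> count y (sub y u t) <= count y u * count y t.
Proof.
  intros hu hK. unfold count, occ at 1. rewrite (weight_sub Pc Po _ _ _ K); auto.
  rewrite (weight_add _ _ _ (occ (ind y) u) (ind y) _ (fun _ => 0)).
  - fold (occ (fun _ => 0) t). rewrite occ_zero; auto.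
  - intro w. destruct (var_eq_dec y w) as [<-|n'].
    + rewrite upd_same, ind_same. unfold occ. lia.
    + rewrite upd_other, ind_other by assumption. lia.
Qed.

(** A linear variable occurs in no non-linear argument of [t], so these arguments are unchanged and
    [Pc] and [Po] need not be checked again. *)
Lemma wf_sub_lin Pc Po K Ku R y u t :
  wf Pc Po K t -> K y = Some Lin -> wf Pc Po Ku u -> no_bnd Ku ->
  kinds_le Ku R -> (forall z, z <> y -> K z = None \/ R z = K z) ->
  wf Pc Po R (sub y u t).
Proof.
  intros h; revert R y u.
  induction h; intros R z v hz hv hb hle hR; simpl.
  - destruct (var_eq_dec z y) as [->|n].
    + now apply wf_kinds with Ku.
    + apply wf_var with m. destruct (hR y); congruence.
  - constructor.
  - constructor.
    + apply IHh; auto.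
      * now rewrite push_up.
      * intro y. specialize (hle y).
        destruct y as [x|i]; [exact hle|now rewrite hb].
      * intros w hw. destruct (var_cases w) as [->|[y ->]]; [now right|].
        rewrite !push_up. apply hR. congruence.
    + intro e. specialize (H e).
      rewrite (count_sub Pc Po Ku), (count_none Pc Po Ku _ v hv (hb 0)); auto; lia.
  - constructor; eauto.
  - rewrite (sub_none Pc Po none z v u); auto. apply wf_app_closed; eauto.
  - assert (z <> y) by congruence.
    rewrite (sub_none Pc Po (only y) z v u); auto.
    + apply wf_app_open with y; eauto. destruct (hR y); congruence.
    + unfold only. rewrite upd_other; [reflexivity|congruence].
  - constructor; eauto.
Qed.

Definition skel : kinds -> aterm -> Prop :=
  wf (fun _ _ => True) (fun _ _ => True).

(** Stated for [skel] because renaming rewrites open arguments, and an arbitrary [Po] need not be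
    stable under that. *)
Lemma wf_ren K R y z t :
  skel K t -> (K y = None \/ R z = K y) ->
  (forall w, w <> y -> K w = None \/ R w = K w) ->
  skel R (ren y z t).
Proof.
  unfold skel; intro h; revert R y z.
  induction h; intros R a z hy hR; simpl.
  - destruct (var_eq_dec a y) as [->|n].
    + apply wf_var with m. destruct hy; congruence.
    + apply wf_var with m. destruct (hR y); congruence.
  - constructor.
  - constructor.
    + apply IHh.
      * now rewrite !push_up.
      * intros w hw. destruct (var_cases w) as [->|[b ->]]; [now right|].
        rewrite !push_up. apply hR. congruence.
    + intro e. specialize (H e). unfold count, occ in *. rewrite weight_ren.
      rewrite (weight_ext _ _ _ _ (ind (Bnd 0))); [assumption|].
      intro w. unfold upd. destruct (var_eq_dec (up a) w) as [<-|]; [|reflexivity].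
      unfold ind. rewrite !upd_other; auto;
        intro e'; symmetry in e'; now apply up_neq0 in e'.
  - constructor; eauto.
  - rewrite (ren_none (fun _ _ => True) (fun _ _ => True) none a z u); auto.
    apply wf_app_closed; eauto.
  - destruct (var_eq_dec a y) as [->|n].
    + apply wf_app_open with z; eauto.
      * destruct hy; congruence.
      * apply IHh2.
        -- right. unfold only. now rewrite !upd_same.
        -- intros w hw. left. unfold only. now rewrite upd_other by congruence.
      * unfold count, occ in *. rewrite weight_ren.
        rewrite (weight_wf (fun _ _ => True) (fun _ _ => True) _ _ _ (only y) u)
          with (v' := ind y); auto.
        intros w hw. unfold only, ind in *.
        destruct (var_eq_dec y w) as [->|]; [now rewrite !upd_same|].
        rewrite upd_other in hw; [now elim hw|assumption].
      * now apply all_levels_ren.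
    + rewrite (ren_none (fun _ _ => True) (fun _ _ => True) (only y) a z u); auto.
      * apply wf_app_open with y; eauto. destruct (hR y); congruence.
      * unfold only. now rewrite upd_other by congruence.
  - constructor; eauto.
Qed.

(** * Potentials *)

Definition stack := list (mode * aterm).

Definition process : Type := aterm * stack.

(** A Krivine machine that substitutes at once. Beta requires equal annotations on both sides;
    realizability will show that unequal ones never meet. *)
Inductive pstep : process -> process -> Prop :=
| p_push m t u s : pstep (AApp m t u, s) (t, (m, u) :: s)
| p_beta m t u s : pstep (ALam m t, (m, u) :: s) (sub (Bnd 0) u t, s)
| p_if0 t u w s : pstep (AIf t u w, s) (t, [])
| p_if1 t u w s : pstep (AIf t u w, s) (u, s)
| p_if2 t u w s : pstep (AIf t u w, s) (w, s).

Inductive psteps : process -> process -> Prop :=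
| ps_refl p : psteps p p
| ps_step p q r : pstep p q -> psteps q r -> psteps p r.

Section Potential.

(* [d] bounds the levels and [m] the size of the initial term. *)
Variables (d m : nat).

Definition kap (k : nat) (a : mode) : nat :=
  match a with
  | Lin => 0
  | Non j => if j <? k then m ^ (3 * 2 ^ k - 3 * 2 ^ j) else 0
  end.

(** A factor [m] for the size of an argument of level [i], times the anticipated weight of a
    variable of level [S i], the lowest level that can be bound in it. *)
Definition own (k i : nat) : nat := m * m ^ (3 * 2 ^ k - 3 * 2 ^ S i).

Definition wlam (k : nat) (a : mode) : nat :=
  if k =? d then 1 else
  match a with Lin => 0 | Non j => if j =? k then 1 else 0 end.

Definition wnode (k : nat) : nat := if k =? d then 1 else 0.

(* For [k < d] this bounds the number of beta steps of level [k] still to come;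
   for [k = d], the number of all steps. *)
Definition pot (k : nat) (t : aterm) : nat :=
  weight (wlam k) (wnode k) (kap k) (fun _ => 0) t.

(* Substituting a closed argument [u] of level [i] into open arguments of the
   same level costs a beta step of level [i] and adds at most [own k i] to
   their potential. *)
Definition closed_ok (N : nat -> nat) (i : nat) (u : aterm) : Prop :=
  i < d /\ forall k, i < k -> pot k u + own k i * N i <= kap k (Non i).

Definition open_ok (i : nat) (u : aterm) : Prop :=
  i < d /\ forall k, i < k -> pot k u <= own k i.

Local Notation wfd N := (wf (closed_ok N) open_ok).

Lemma wfd_le N N' K t :
  (forall i, N' i <= N i) -> wfd N K t -> wfd N' K t.
Proof.
  intro h. apply wf_impl; auto.
  - intros i u [hi hu]. split; [assumption|]. intros k hk.
    specialize (hu k hk). specialize (h i). nia.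
  - intro y; destruct (K y) as [[]|]; easy.
Qed.

Lemma pot_sub_count N y u t k :
  wfd N none u -> pot k (sub y u t) <= pot k t + pot k u * count y t.
Proof.
  intro hu. unfold pot. erewrite weight_sub; [|exact hu|apply no_bnd_none].
  apply weight_add. intro z. unfold ind.
  destruct (var_eq_dec y z) as [<-|n].
  - rewrite !upd_same. lia.
  - rewrite !upd_other by assumption. lia.
Qed.

(** The arguments containing [y] are open ones of level [i], which now become closed. Each has
    potential at most [own k i] plus that of [u] counted once, and the beta step just spent,
    [N' i < N i], pays for this [own k i]. *)
Lemma wfd_sub_non N N' K R i y u t :
  wfd N K t -> K y = Some (Non i) ->
  wfd N none u -> all_levels (lt i) u -> closed_ok N i u ->
  (forall j, N' j <= N j) -> N' i < N i ->
  (forall z, z <> y -> R z = K z) ->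
  wfd N' R (sub y u t).
Proof.
  intros h hy hu hl hc hN hi hR.
  assert (hu' : wfd N' none u) by now apply wfd_le with N.
  revert R y hy hR.
  induction h; intros R z hy hR; simpl.
  - destruct (var_eq_dec z y) as [->|n].
    + apply wf_kinds with none; [intro; exact I|assumption].
    + apply wf_var with m0. rewrite hR; congruence.
  - constructor.
  - constructor.
    + apply IHh; auto.
      * now rewrite push_up.
      * intros w hw. destruct (var_cases w) as [->|[a ->]]; [reflexivity|].
        rewrite !push_up. apply hR. congruence.
    + intro e. specialize (H e).
      pose proof (count_sub _ _ _ (Bnd 0) (up z) _ t hu no_bnd_none) as hs.
      rewrite (count_none _ _ _ _ _ hu eq_refl) in hs. lia.
  - constructor; eauto.
  - erewrite (sub_none _ _ none z u u0); [|eassumption|reflexivity].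
    apply wf_app_closed; eauto.
    + now apply wfd_le with N.
    + destruct H0 as [h0 hp]. split; [assumption|]. intros k hk.
      specialize (hp k hk). specialize (hN i0). nia.
  - destruct (var_eq_dec z y) as [->|n].
    (* The argument is closed by the substitution: it moves from [open_ok] to [closed_ok]. *)
    + assert (i0 = i) as -> by congruence. apply wf_app_closed; eauto.
      * apply wf_sub_lin with (K := only y) (Ku := none).
        -- now apply wfd_le with N.
        -- unfold only. now rewrite upd_same.
        -- assumption.
        -- apply no_bnd_none.
        -- intro; exact I.
        -- intros w hw. left. unfold only. rewrite upd_other; [reflexivity|congruence].
      * now apply all_levels_sub.
      * destruct H2 as [h0 hp], hc as [_ hc]. split; [assumption|].
        intros k hk. specialize (hp k hk). specialize (hc k hk).
        pose proof (pot_sub_count N y u u0 k hu). nia.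
    + erewrite (sub_none _ _ (only y) z u u0); [|eassumption|].
      * apply wf_app_open with y; eauto; [rewrite hR; congruence|].
        now apply wfd_le with N.
      * unfold only. rewrite upd_other; [reflexivity|congruence].
  - constructor; eauto.
Qed.

(** For [k <> d] weight comes only from abstractions of level [k] and from variables bound at levels
    below [k]; levels above [i >= k] provide neither. *)
Lemma pot_above i k u : k <= i -> k <> d -> all_levels (lt i) u -> pot k u = 0.
Proof.
  intros hk hd. unfold pot. apply Nat.eqb_neq in hd.
  enough (h : forall v, (forall y, v y = 0) -> all_levels (lt i) u ->
    weight (wlam k) (wnode k) (kap k) v u = 0) by (apply h; auto).
  unfold wlam, wnode; rewrite hd.
  induction u as [x|b|a t IH|a t IHt w IHw|]; intros v hv hl; simpl in *; auto.
  - destruct hl as [ha hl]. rewrite IH; auto.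
    + destruct a as [|j]; [reflexivity|].
      destruct (Nat.eqb_spec j k); lia.
    + intro y. destruct (var_cases y) as [->|[z ->]]; [|rewrite push_up; auto].
      simpl. destruct a as [|j]; [reflexivity|]. simpl.
      destruct (Nat.ltb_spec j k); lia.
  - destruct hl as (ha & ht & hw). rewrite IHt by auto.
    destruct a; [rewrite IHw|]; auto.
  - destruct hl as (h1 & h2 & h3). now rewrite IHu1, IHu2, IHu3.
Qed.

Definition entry_pot (k : nat) (e : mode * aterm) : nat :=
  match fst e with Lin => pot k (snd e) | Non _ => 0 end.

Definition stack_pot (k : nat) (s : stack) : nat :=
  list_sum (map (entry_pot k) s).

Definition proc_pot (k : nat) (p : process) : nat :=
  pot k (fst p) + stack_pot k (snd p).

Definition entry_ok (N : nat -> nat) (e : mode * aterm) : Prop :=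
  wfd N none (snd e) /\
  match fst e with
  | Lin => True
  | Non i => all_levels (lt i) (snd e) /\ closed_ok N i (snd e)
  end.

Definition proc_ok_at (N : nat -> nat) (p : process) : Prop :=
  wfd N none (fst p) /\ Forall (entry_ok N) (snd p).

(** The budget is the potential of the process itself. Validity of a process yields the decrease of
    the potential at the next step, which in turn yields validity of the next process. *)
Definition proc_ok (p : process) : Prop :=
  proc_ok_at (fun i => proc_pot i p) p.

Lemma entry_ok_le N N' e :
  (forall i, N' i <= N i) -> entry_ok N e -> entry_ok N' e.
Proof.
  intros hN [h1 h2]. split; [now apply wfd_le with N|].
  destruct (fst e) as [|i]; [exact I|]. destruct h2 as [h2 [h3 h4]].
  split; [assumption|split; [assumption|]]. intros k hk.
  specialize (h4 k hk). specialize (hN i). nia.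
Qed.

Lemma proc_ok_at_le N N' p :
  (forall i, N' i <= N i) -> proc_ok_at N p -> proc_ok_at N' p.
Proof.
  intros hN [h1 h2]. split; [now apply wfd_le with N|].
  eapply Forall_impl; [|exact h2]. intro e. now apply entry_ok_le.
Qed.

(** A linear argument is charged on the stack and moves to at most one occurrence. A non-linear one
    is free there, because [kap] has already charged it at each occurrence. The term [wnode k] makes
    the decrease strict at [k = d]. *)
Lemma proc_pot_step p q k :
  proc_ok p -> pstep p q -> proc_pot k q + wnode k <= proc_pot k p.
Proof.
  intros [h1 h2] hs.
  destruct hs as [a t u s|a t u s|t u w s|t u w s|t u w s]; simpl in h1, h2;
    unfold proc_pot, stack_pot, entry_pot; unfold pot; simpl; fold (pot k).
  - destruct a; lia.
  - inversion h2 as [|? ? [hu he] hs]; subst; simpl in *.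
    inversion h1 as [| |? ? ? ht hc| | | |]; subst.
    assert (hw : wnode k <= wlam k a).
    { unfold wnode, wlam. destruct (k =? d); lia. }
    erewrite weight_sub; [|exact hu|apply no_bnd_none].
    destruct a as [|i].
    + specialize (hc eq_refl).
      assert (h : pot k (sub (Bnd 0) u t) <= pot k t + pot k u * count (Bnd 0) t)
        by (eapply pot_sub_count; exact hu).
      unfold pot at 1 in h. erewrite weight_sub in h;
        [|exact hu|apply no_bnd_none].
      assert (e : weight (wlam k) (wnode k) (kap k) (push 0 (fun _ => 0)) t = pot k t).
      { apply weight_ext. intros [|[]]; reflexivity. }
      simpl kap in *. rewrite e. unfold pot in *. nia.
    + destruct he as [hl [hi hk]].
      assert (h : weight (wlam k) (wnode k) (kap k)
        (upd (fun _ => 0) (Bnd 0) (pot k u)) t <=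
        weight (wlam k) (wnode k) (kap k) (push (kap k (Non i)) (fun _ => 0)) t).
      { apply weight_mono. intro y. destruct (var_cases y) as [->|[z ->]].
        - rewrite upd_same. simpl push.
          (* For [k > i] the weight was anticipated by [closed_ok]; for [k <= i] it is 0 by
             [pot_above], where [k <> d] follows from [i < d]. *)
          destruct (Nat.lt_ge_cases i k) as [l|l].
          + apply Nat.le_trans with (2 := hk k l). apply Nat.le_add_r.
          + rewrite (pot_above i); auto; lia.
        - rewrite upd_other; [lia|]. intro e; symmetry in e; now apply up_neq0 in e. }
      unfold pot in h at 1. lia.
  - lia.
  - lia.
  - lia.
Qed.

(** At level [i] the contracted abstraction weighs 1, while the argument has only higher levels and
    weighs 0 wherever it lands. *)
Lemma proc_pot_beta i t u s :
  proc_ok (ALam (Non i) t, (Non i, u) :: s) ->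
  proc_pot i (sub (Bnd 0) u t, s) < proc_pot i (ALam (Non i) t, (Non i, u) :: s).
Proof.
  intros [h1 h2]; simpl in h1, h2.
  inversion h2 as [|? ? [hu he] hs]; subst; simpl in hu, he.
  destruct he as [hl [hi hk]].
  unfold proc_pot, stack_pot, entry_pot; unfold pot; simpl; fold (pot i).
  erewrite weight_sub; [|exact hu|apply no_bnd_none].
  replace (wlam i (Non i)) with 1
    by (unfold wlam; rewrite Nat.eqb_refl; destruct (i =? d); reflexivity).
  enough (weight (wlam i) (wnode i) (kap i)
        (upd (fun _ => 0) (Bnd 0) (pot i u)) t <=
        weight (wlam i) (wnode i) (kap i)
          (push (if i <? i then m ^ (3 * 2 ^ i - 3 * 2 ^ i) else 0) (fun _ => 0)) t)
    by (unfold pot in *; simpl in *; lia).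
  apply weight_mono. intro y. rewrite (pot_above i); auto; [|lia].
  unfold upd. destruct (var_eq_dec (Bnd 0) y); lia.
Qed.

(** Untouched arguments survive since budgets only shrink. A non-linear beta step of level [i]
    spends a unit of the budget at [i], which is what [wfd_sub_non] asks for. *)
Lemma proc_ok_step p q : proc_ok p -> pstep p q -> proc_ok q.
Proof.
  intros hp hs.
  assert (hN : forall i, proc_pot i q <= proc_pot i p).
  { intro i. pose proof (proc_pot_step p q i hp hs). lia. }
  destruct hs as [a t u s|a t u s|t u w s|t u w s|t u w s];
    pose proof hp as [h1 h2]; simpl in h1, h2.
  - apply (proc_ok_at_le _ _ _ hN).
    inversion h1; subst; split; simpl; auto; constructor; auto; split; simpl; auto.
    + discriminate.
    + discriminate.
  - inversion h2 as [|? ? he hs]; subst.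
    assert (hs' : Forall (entry_ok (fun i => proc_pot i (sub (Bnd 0) u t, s))) s).
    { eapply Forall_impl; [|exact hs]. intro e. now apply entry_ok_le. }
    split; [|assumption]. simpl.
    destruct he as [hu he]; simpl in hu, he.
    inversion h1 as [| |? ? ? ht hc| | | |]; subst.
    destruct a as [|i].
    + apply wf_sub_lin with (K := push (Some Lin) none) (Ku := none).
      * now apply wfd_le with (2 := ht).
      * reflexivity.
      * now apply wfd_le with (2 := hu).
      * apply no_bnd_none.
      * intro; exact I.
      * intros z hz. left. destruct z as [|[]]; auto. congruence.
    + destruct he as [hl hk].
      eapply wfd_sub_non with (K := push (Some (Non i)) none);
        [exact ht|reflexivity|exact hu|exact hl|exact hk|exact hN| |].
      * now apply proc_pot_beta.
      * intros z hz. destruct z as [|[]]; auto. congruence.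
  - apply (proc_ok_at_le _ _ _ hN). inversion h1; subst; split; simpl; auto.
  - apply (proc_ok_at_le _ _ _ hN). inversion h1; subst; split; simpl; auto.
  - apply (proc_ok_at_le _ _ _ hN). inversion h1; subst; split; simpl; auto.
Qed.

(** * Potential of the initial term *)

Lemma pot_le_size i k u :
  0 < m -> all_levels (le i) u ->
  pot k u <= size (erase u) * m ^ (3 * 2 ^ k - 3 * 2 ^ i).
Proof.
  intros hm hu. unfold pot.
  apply weight_bound with (P := le i); auto.
  - pose proof (Nat.pow_nonzero m (3 * 2 ^ k - 3 * 2 ^ i)). lia.
  - unfold wnode. destruct (k =? d); lia.
  - intro a. unfold wlam. destruct (k =? d); [lia|].
    destruct a as [|j]; [lia|]. destruct (j =? k); lia.
  - simpl. lia.
  - intros j hj. simpl kap. destruct (j <? k); [|lia].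
    apply Nat.pow_le_mono_r; [lia|].
    pose proof (Nat.pow_le_mono_r 2 i j). lia.
  - intro y. lia.
Qed.

Lemma pot_le_own i u k :
  0 < m -> all_levels (lt i) u -> size (erase u) <= m -> pot k u <= own k i.
Proof.
  intros hm hu hs. unfold own.
  apply Nat.le_trans with (1 := pot_le_size (S i) k u hm hu).
  now apply Nat.mul_le_mono_r.
Qed.

(** This dictates the exponents. Passing from level [S i] to [i] gains [3 * 2 ^ i] factors [m]: one
    for the size in [own], one for the successor in [1 + n], and [3 * 2 ^ i - 2] for the bound on
    [n]. *)
Lemma own_le_kap i k n :
  2 <= m -> i < k -> n <= m ^ (3 * 2 ^ i - 2) ->
  own k i + own k i * n <= kap k (Non i).
Proof.
  intros hm hk hn. unfold kap, own. apply Nat.ltb_lt in hk as e. rewrite e.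
  assert (h1 : 2 ^ S i <= 2 ^ k) by (apply Nat.pow_le_mono_r; lia).
  rewrite Nat.pow_succ_r' in *.
  assert (h2 : 2 ^ i <> 0) by (apply Nat.pow_nonzero; lia).
  set (a := 2 ^ k) in *. set (c := 2 ^ i) in *.
  replace (3 * a - 3 * c) with ((3 * a - 3 * (2 * c)) + S (S (3 * c - 2))) by lia.
  rewrite Nat.pow_add_r, 2!Nat.pow_succ_r'.
  set (p := m ^ (3 * a - 3 * (2 * c))).
  assert (h3 : m ^ (3 * c - 2) <> 0) by (apply Nat.pow_nonzero; lia).
  set (q := m ^ (3 * c - 2)) in *.
  assert (1 + n <= m * q) by nia.
  replace (m * p + m * p * n) with (p * (m * (1 + n))) by ring.
  apply Nat.mul_le_mono_l, Nat.mul_le_mono_l; assumption.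
Qed.

(** Arguments inside [t] also have size at most [m], so [own] bounds their potential; for closed
    ones [own_le_kap] leaves room for [N i] beta steps. *)
Lemma skel_wfd N K t :
  2 <= m -> skel K t -> all_levels (fun j => j < d) t -> size (erase t) <= m ->
  (forall i, N i <= m ^ (3 * 2 ^ i - 2)) -> wfd N K t.
Proof.
  intros hm h hl hs hN; revert hl hs.
  induction h as [K y a e|K b|K a t _ IH c|K t u _ IHt _ IHu|K i t u _ IHt _ IHu hu _
    |K i y t u _ IHt e _ IHu c hu _|K t u w _ IHt _ IHu _ IHw]; simpl; intros hl hs.
  - now apply wf_var with a.
  - constructor.
  - constructor; [|assumption]. apply IH; [tauto|lia].
  - constructor; [apply IHt|apply IHu]; tauto || lia.
  - apply wf_app_closed; [apply IHt|apply IHu|assumption|]; try tauto; try lia.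
    split; [tauto|]. intros k hk.
    pose proof (own_le_kap i k (N i) hm hk (hN i)).
    assert (pot k u <= own k i) by (apply pot_le_own; auto; lia). lia.
  - apply wf_app_open with y; [apply IHt| |apply IHu| | |]; try tauto; try lia.
    split; [tauto|]. intros k hk. apply pot_le_own; auto; lia.
  - constructor; [apply IHt|apply IHu|apply IHw]; tauto || lia.
Qed.

(** The size contributes one factor [m], and each node weighs at most [m ^ (3 * 2 ^ k - 3)], the
    case of level 0. *)
Lemma pot_init k t :
  0 < m -> size (erase t) <= m -> pot k t <= m ^ (3 * 2 ^ k - 2).
Proof.
  intros hm hs.
  assert (hl : all_levels (le 0) t).
  { clear hs. induction t as [| |[]|[]|]; simpl; auto using Nat.le_0_l. }
  apply Nat.le_trans with (1 := pot_le_size 0 k t hm hl).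
  assert (2 ^ k <> 0) by (apply Nat.pow_nonzero; lia).
  replace (3 * 2 ^ k - 2) with (S (3 * 2 ^ k - 3 * 2 ^ 0)) by (simpl (2 ^ 0); lia).
  rewrite Nat.pow_succ_r'. now apply Nat.mul_le_mono_r.
Qed.

Lemma proc_ok_init t :
  2 <= m -> skel none t -> all_levels (fun j => j < d) t -> size (erase t) <= m ->
  proc_ok (t, []).
Proof.
  intros hm ht hl hs. split; [|constructor].
  apply skel_wfd; auto. intro i. unfold proc_pot. simpl.
  rewrite Nat.add_0_r. apply pot_init; auto; lia.
Qed.

End Potential.

(** * Realizability *)

Definition clash (p : process) : Prop :=
  match p with
  | (ALam m _, (m', _) :: _) => m <> m'
  | _ => False
  end.

(** Coinductive, since safety only excludes clashes along all runs, infinite ones included;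
    termination comes from the potential. *)
CoInductive safe (p : process) : Prop :=
| safe_intro : ~ clash p -> (forall q, pstep p q -> safe q) -> safe p.

Definition sem := nat -> stack -> Prop.

(** Local closure is included so that realizers can be substituted without lifting. *)
Definition realizes (S : stack -> Prop) (t : aterm) : Prop :=
  lcat 0 t /\ forall s, S s -> safe (t, s).

Definition scons (X : sem) (e : nat -> sem) : nat -> sem :=
  fun i => match i with 0 => X | S i => e i end.

(* The stacks against which the realizers of [A], read at level [l], are safe;
   a type variable denotes an arbitrary family of sets of stacks. *)
Fixpoint stacks (A : ty) (r : name -> sem) (e : nat -> sem) (l : nat)
    (s : stack) : Prop :=
  match A with
  | TVar a => r a l s
  | TIdx i => e i l s
  | TLin A B =>
      match s with
      | (Lin, u) :: s => realizes (stacks A r e l) u /\ stacks B r e l s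
      | _ => False
      end
  | TImp A B =>
      match s with
      | (Non j, u) :: s =>
          j = l /\ realizes (stacks A r e (S l)) u /\ stacks B r e l s
      | _ => False
      end
  | TPar A => stacks A r e (S l) s
  | TAll A => exists X, stacks A r (scons X e) l s
  | TBool => s = []
  end.

Lemma realizes_iff (S S' : stack -> Prop) t :
  (forall s, S s <-> S' s) -> realizes S t <-> realizes S' t.
Proof. intro h. unfold realizes. firstorder. Qed.

Lemma stacks_ext A : forall k r r' e e' l s,
  lc_ty_at k A ->
  (forall a, In a (ftv A) -> forall l s, r a l s <-> r' a l s) ->
  (forall i, i < k -> forall l s, e i l s <-> e' i l s) ->
  stacks A r e l s <-> stacks A r' e' l s.
Proof.
  induction A as [a|i|A IHA B IHB|A IHA B IHB|A IHA|A IHA|];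
    intros k r r' e e' l s hk hr he; simpl in *.
  - apply hr; auto.
  - apply he; auto.
  - destruct s as [|[[|j] u] s]; try tauto.
    rewrite (IHB k r r' e e'); try tauto; [|intros; apply hr, in_or_app; auto].
    rewrite (realizes_iff _ (stacks A r' e' l)); [tauto|].
    intro s'. apply IHA with k; try tauto. intros; apply hr, in_or_app; auto.
  - destruct s as [|[[|j] u] s]; try tauto.
    rewrite (IHB k r r' e e'); try tauto; [|intros; apply hr, in_or_app; auto].
    rewrite (realizes_iff _ (stacks A r' e' (S l))); [tauto|].
    intro s'. apply IHA with k; try tauto. intros; apply hr, in_or_app; auto.
  - apply IHA with k; auto.
  - assert (h : forall X, stacks A r (scons X e) l s <-> stacks A r' (scons X e') l s).
    { intro X. apply IHA with (S k); auto.
      intros [|i] hi l' s'; simpl; [tauto|apply he; lia]. }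
    firstorder.
  - tauto.
Qed.

(** Assignments are compared pointwise up to equivalence, so that the induction passes under
    quantifiers without extensionality. *)
Lemma stacks_open B (hB : lc_ty B) A : forall k r e e' l s,
  (forall l s, e' k l s <-> stacks B r e l s) ->
  (forall i, i <> k -> forall l s, e' i l s <-> e i l s) ->
  stacks (ty_open_at k B A) r e l s <-> stacks A r e' l s.
Proof.
  induction A as [a|i|A IHA A' IHA'|A IHA A' IHA'|A IHA|A IHA|];
    intros k r e e' l s hk he; simpl in *.
  - tauto.
  - destruct (Nat.eqb_spec i k) as [->|n]; simpl.
    + now rewrite hk.
    + now rewrite he.
  - destruct s as [|[[|j] u] s]; try tauto.
    rewrite (IHA' k r e e'); auto.
    rewrite (realizes_iff _ (stacks A r e' l)); [tauto|].
    intro s'. apply IHA; auto.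
  - destruct s as [|[[|j] u] s]; try tauto.
    rewrite (IHA' k r e e'); auto.
    rewrite (realizes_iff _ (stacks A r e' (S l))); [tauto|].
    intro s'. apply IHA; auto.
  - apply IHA; auto.
  - assert (h : forall X, stacks (ty_open_at (S k) B A) r (scons X e) l s <->
      stacks A r (scons X e') l s).
    { intro X. apply IHA.
      (* [B] has no dangling index, so the candidate [X] pushed on the assignment does not affect
         it. *)
      - intros l' s'. simpl. rewrite hk. apply stacks_ext with 0; auto; [tauto|lia].
      - intros [|i] hi l' s'; simpl; [tauto|]. apply he; lia. }
    firstorder.
  - tauto.
Qed.

Definition updr (r : name -> sem) (a : name) (X : sem) : name -> sem :=
  fun b => if Nat.eqb a b then X else r b.

Lemma stacks_close a A : forall k r e l s,
  stacks (ty_close_at k a A) r e l s <-> stacks A (updr r a (e k)) e l s.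
Proof.
  induction A as [b|i|A IHA B IHB|A IHA B IHB|A IHA|A IHA|];
    intros k r e l s; simpl in *.
  - unfold updr. destruct (Nat.eqb_spec a b); simpl; tauto.
  - tauto.
  - destruct s as [|[[|j] u] s]; try tauto.
    rewrite IHB, (realizes_iff _ (stacks A (updr r a (e k)) e l)); [tauto|].
    intro; apply IHA.
  - destruct s as [|[[|j] u] s]; try tauto.
    rewrite IHB, (realizes_iff _ (stacks A (updr r a (e k)) e (S l))); [tauto|].
    intro; apply IHA.
  - apply IHA.
  - assert (h : forall X, stacks (ty_close_at (S k) a A) r (scons X e) l s <->
      stacks A (updr r a (e k)) (scons X e) l s)
      by exact (fun X => IHA (S k) r (scons X e) l s).
    firstorder.
  - tauto.
Qed.

Lemma stacks_pars_bool n r e l : stacks (pars n TBool) r e l [].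
Proof. revert l; induction n; intro l; simpl; auto. Qed.

Lemma lc_ty_le A : forall k k', k <= k' -> lc_ty_at k A -> lc_ty_at k' A.
Proof.
  induction A; intros k k' h; simpl; try tauto; try lia.
  - intros [h1 h2]; split; eauto.
  - intros [h1 h2]; split; eauto.
  - eauto.
  - apply IHA; lia.
Qed.

Lemma lc_ty_open B (hB : lc_ty B) A : forall k,
  lc_ty_at (S k) A -> lc_ty_at k (ty_open_at k B A).
Proof.
  induction A; intro k; simpl; auto.
  - intro h. destruct (Nat.eqb_spec i k); simpl; [|lia].
    apply lc_ty_le with 0; [lia|assumption].
  - intros []; auto.
  - intros []; auto.
Qed.

Lemma lc_ty_close a A : forall k, lc_ty_at k A -> lc_ty_at (S k) (ty_close_at k a A).
Proof.
  induction A; intro k; simpl; auto.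
  - intros _. destruct (Nat.eqb a a0); simpl; lia.
  - intros []; auto.
  - intros []; auto.
Qed.

(** * Well-formedness of the contexts of derivable judgements *)

Lemma dom_app G D : dom (G ++ D) = dom G ++ dom D.
Proof. apply map_app. Qed.

Lemma dom_par D : dom (ctx_par D) = dom D.
Proof. unfold dom, ctx_par. rewrite map_map. reflexivity. Qed.

Lemma wf_ctxs_drop_lin G D p : wf_ctxs G (p :: D) -> wf_ctxs G D.
Proof.
  intros [h1 h2]. split.
  - rewrite dom_app in *. simpl in h1. now apply NoDup_remove_1 in h1.
  - rewrite Forall_app in *. destruct h2 as [h2 h3]. inversion h3; auto.
Qed.

Lemma wf_ctxs_drop_non G D p : wf_ctxs (p :: G) D -> wf_ctxs G D.
Proof. intros [h1 h2]. inversion h1; inversion h2; split; assumption. Qed.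

Lemma wf_ctxs_perm G G' D D' :
  Permutation G G' -> Permutation D D' -> wf_ctxs G D -> wf_ctxs G' D'.
Proof.
  intros hG hD [h1 h2].
  pose proof (Permutation_app hG hD) as h. split.
  - eapply Permutation_NoDup; [|exact h1]. now apply Permutation_map.
  - eapply Permutation_Forall; eassumption.
Qed.

Lemma deriv_regular G D t A : deriv G D t A -> wf_ctxs G D /\ lc_ty A.
Proof.
  induction 1; try (split; [assumption|]); try tauto.
  - split; [eapply wf_ctxs_perm; eauto; tauto|tauto].
  - split; [split; repeat constructor; simpl; auto|assumption].
  - destruct IHderiv as [h1 h2]. split; [eapply wf_ctxs_drop_lin; eauto|].
    split; [|assumption]. destruct h1 as [_ h1].
    apply Forall_app in h1 as [_ h1]. now inversion h1.
  - destruct IHderiv1 as [_ [_ h]]; exact h.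
  - destruct IHderiv as [h1 h2]. split; [eapply wf_ctxs_drop_non; eauto|].
    split; [|assumption]. destruct h1 as [_ h1]. now inversion h1.
  - destruct IHderiv1 as [_ [_ h]]; exact h.
  - destruct IHderiv1 as [h1 [_ h]]; split; assumption.
  - destruct IHderiv as [[h1 h2] h3]. split; [split|exact h3].
    + simpl in h1. rewrite dom_app in *. now rewrite dom_par.
    + simpl in h2. rewrite Forall_app in *. destruct h2 as [h2 h4].
      split; [assumption|]. unfold ctx_par. now rewrite Forall_map.
  - destruct IHderiv as [h1 h2]. split; [assumption|]. now apply lc_ty_close.
  - destruct IHderiv as [h1 h2]. split; [assumption|]. now apply lc_ty_open.
  - split; [split; constructor|exact I].
  - split; [split; constructor|exact I].
Qed.

(** * Annotating derivations *)

Definition kinds_of (l : nat) (G D : ctx) : kinds :=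
  fun y => match y with
           | Bnd _ => None
           | Free x =>
               if in_dec Nat.eq_dec x (dom D) then Some Lin
               else if in_dec Nat.eq_dec x (dom G) then Some (Non l) else None
           end.

Lemma kinds_of_incl l G G' D D' :
  incl (dom G) (dom G') -> incl (dom D) (dom D') ->
  (forall x, In x (dom G') -> ~ In x (dom D')) ->
  kinds_le (kinds_of l G D) (kinds_of l G' D').
Proof.
  intros hG hD hn [x|i]; simpl; [|exact I].
  destruct (in_dec Nat.eq_dec x (dom D)) as [i|n], (in_dec Nat.eq_dec x (dom D')) as [i'|n'];
    try easy.
  - now elim n'; apply hD.
  - destruct (in_dec Nat.eq_dec x (dom G)) as [i|]; [|exact I]. elim (hn x); auto.
  - destruct (in_dec Nat.eq_dec x (dom G)) as [i|]; [|exact I].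
    destruct (in_dec Nat.eq_dec x (dom G')); [reflexivity|]. elim n0; auto.
Qed.

Lemma wf_ctxs_disjoint G D x : wf_ctxs G D -> In x (dom G) -> ~ In x (dom D).
Proof.
  intros [h _] hG hD. rewrite dom_app in h.
  apply in_split in hG as (l1 & l2 & e). rewrite e, <- app_assoc in h. simpl in h.
  apply NoDup_remove_2 in h. apply h. rewrite !in_app_iff. auto.
Qed.

Lemma wf_ctxs_app_disjoint G1 G2 D1 D2 :
  wf_ctxs (G1 ++ G2) (D1 ++ D2) ->
  (forall x, In x (dom D1) -> ~ In x (dom G2) /\ ~ In x (dom D2)) /\
  (forall x, In x (dom D2) -> ~ In x (dom G1) /\ ~ In x (dom D1)).
Proof.
  intro hw.
  assert (h : forall x, In x (dom D1) -> ~ In x (dom D2)).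
  { intros x hx hx'. destruct hw as [h _]. rewrite !dom_app in h.
    apply NoDup_app_remove_l in h.
    apply in_split in hx as (a & b & e). rewrite e, <- app_assoc in h.
    apply NoDup_remove_2 in h. apply h. rewrite !in_app_iff. auto. }
  assert (h' : forall x, In x (dom G1) \/ In x (dom G2) ->
    ~ (In x (dom D1) \/ In x (dom D2))).
  { intros x. pose proof (wf_ctxs_disjoint _ _ x hw) as hx.
    now rewrite !dom_app, !in_app_iff in hx. }
  split; intros x hx; split; intro hx'; firstorder.
Qed.

(** [l] is the level at which the subterm is read and [n] the depth available below it. Names of [G]
    are realized at [S l], where the arguments replacing them live. *)
Record annot (G D : ctx) (t : term) (A : ty) (n l : nat) (s : aterm) : Prop := {
  an_erase : erase s = t;
  an_skel : skel (kinds_of l G D) s;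
  an_count : forall x, In x (dom D) -> count (Free x) s <= 1;
  an_levels : all_levels (fun j => l <= j <= l + n) s;
  an_sem : forall r e g,
    (forall x, lcat 0 (g x)) ->
    (forall x B, In (x, B) G -> realizes (stacks B r e (S l)) (g x)) ->
    (forall x B, In (x, B) D -> realizes (stacks B r e l) (g x)) ->
    realizes (stacks A r e l) (msub g s)
}.

Lemma skel_lcat l G D s : skel (kinds_of l G D) s -> lcat 0 s.
Proof. intro h. eapply wf_lcat; [exact h|]. reflexivity. Qed.

Lemma count_outside l G D s x :
  skel (kinds_of l G D) s -> ~ In x (dom G) -> ~ In x (dom D) ->
  count (Free x) s = 0.
Proof.
  intros h hG hD. eapply count_none; [exact h|]. simpl.
  destruct (in_dec Nat.eq_dec x (dom D)); [tauto|]. destruct (in_dec Nat.eq_dec x (dom G)); tauto.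
Qed.

Lemma in_dom x (A : ty) G : In (x, A) G -> In x (dom G).
Proof. apply (in_map fst). Qed.

Lemma annot_incl G G' D D' t A n n' l s :
  incl G G' -> incl D D' -> wf_ctxs G' D' -> n <= n' ->
  annot G D t A n l s -> annot G' D' t A n' l s.
Proof.
  intros hG hD hw hn [he hs hc hl hm].
  assert (hG' : incl (dom G) (dom G')) by now apply incl_map.
  assert (hD' : incl (dom D) (dom D')) by now apply incl_map.
  constructor; auto.
  - eapply wf_kinds; [|exact hs]. apply kinds_of_incl; auto.
    intros x. now apply wf_ctxs_disjoint.
  - intros x hx. destruct (in_dec Nat.eq_dec x (dom D)); auto.
    rewrite (count_outside _ _ _ _ x hs); auto. intro i.
    now apply (wf_ctxs_disjoint _ _ x hw); auto.
  - eapply all_levels_impl; [|exact hl]. simpl; intros; lia.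
Qed.

Lemma skel_close K K' m x s :
  skel K s -> no_bnd K -> K (Free x) = Some m ->
  (forall y, y <> x -> K' (Free y) = K (Free y)) ->
  skel (push (Some m) K') (ren (Free x) (Bnd 0) s).
Proof.
  intros hs hb hx hK. apply wf_ren with K; auto.
  intros [y|i] hy; [right|left; apply hb]. apply hK. congruence.
Qed.

Lemma count_close_bnd K x s :
  skel K s -> no_bnd K ->
  count (Bnd 0) (ren (Free x) (Bnd 0) s) = count (Free x) s.
Proof.
  intros hs hb. unfold count, occ. rewrite weight_ren.
  eapply weight_wf; [exact hs|]. intros [y|i] hy; [|now rewrite hb in hy].
  unfold ind, upd. destruct (var_eq_dec (Free x) (Free y)); [|].
  - destruct (var_eq_dec (Bnd 0) (Bnd 0)); congruence.
  - destruct (var_eq_dec (Bnd 0) (Free y)); congruence.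
Qed.

Lemma count_close_free m x y s :
  y <> x -> count (Free y) (ALam m (ren (Free x) (Bnd 0) s)) = count (Free y) s.
Proof.
  intro n. unfold count, occ. simpl. rewrite weight_ren.
  apply weight_ext. intro z. simpl.
  destruct (var_eq_dec (Free x) z) as [<-|n'].
  - rewrite upd_same. unfold ind. rewrite upd_other; congruence.
  - rewrite upd_other by assumption. apply ind_push.
Qed.

(** Anti-reduction: the annotations agree and the only step leads to a safe process. *)
Lemma safe_lam m t u s :
  safe (sub (Bnd 0) u t, s) -> safe (ALam m t, (m, u) :: s).
Proof.
  intro h. constructor; [simpl; auto|]. intros q hq. inversion hq; subst.
  assumption.
Qed.

Lemma safe_app m t u s : safe (t, (m, u) :: s) -> safe (AApp m t u, s).
Proof.
  intro h. constructor; [simpl; auto|]. intros q hq. inversion hq; subst.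
  assumption.
Qed.

Lemma annot_lin_i G D x A t B n l s :
  wf_ctxs G ((x, A) :: D) -> annot G ((x, A) :: D) t B n l s ->
  annot G D (lam x t) (TLin A B) n l (ALam Lin (ren (Free x) (Bnd 0) s)).
Proof.
  intros hw [he hs hc hl hm].
  assert (hx : ~ In x (dom G) /\ ~ In x (dom D)).
  { destruct hw as [h _]. rewrite dom_app in h. simpl in h.
    apply NoDup_remove_2 in h. rewrite in_app_iff in h. tauto. }
  assert (hb : no_bnd (kinds_of l G ((x, A) :: D))) by (intro; reflexivity).
  assert (hs' : skel (kinds_of l G D) (ALam Lin (ren (Free x) (Bnd 0) s))).
  { constructor.
    - eapply skel_close; [exact hs|exact hb| |].
      + simpl. destruct (Nat.eq_dec x x); [reflexivity|congruence].
      + intros y hy. simpl. destruct (Nat.eq_dec x y); [congruence|].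
        destruct (in_dec Nat.eq_dec y (dom D)); reflexivity.
    - intros _. erewrite count_close_bnd; [|exact hs|exact hb].
      apply hc; left; reflexivity. }
  constructor; auto.
  - unfold lam. simpl. now rewrite erase_ren_close, he.
  - intros y hy. rewrite count_close_free; [|intros ->; tauto].
    apply hc; now right.
  - split; [exact I|]. now apply all_levels_ren.
  - intros r e g hg hG hD. split.
    { apply lcat_msub; [assumption|]. eapply skel_lcat; exact hs'. }
    intros [|[[|j] u] st]; try now intros [].
    intros [hu hst]. apply safe_lam.
    rewrite open_msub_close; [|assumption|eapply skel_lcat; exact hs].
    apply (hm r e); [| | |exact hst].
    + intro y. unfold updn. destruct (Nat.eqb x y); [apply hu|auto].
    + intros y C hy. rewrite updn_other; auto.
      intros ->. apply in_dom in hy; tauto.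
    + intros y C [hy|hy].
      * injection hy as <- <-. now rewrite updn_same.
      * rewrite updn_other; auto. intros ->. apply in_dom in hy; tauto.
Qed.

Lemma annot_imp_i G D x A t B n l s :
  wf_ctxs ((x, A) :: G) D -> annot ((x, A) :: G) D t B n l s ->
  annot G D (lam x t) (TImp A B) n l (ALam (Non l) (ren (Free x) (Bnd 0) s)).
Proof.
  intros hw [he hs hc hl hm].
  assert (hx : ~ In x (dom G) /\ ~ In x (dom D)).
  { destruct hw as [h _]. simpl in h. inversion h as [|? ? h' _].
    rewrite dom_app, in_app_iff in h'. tauto. }
  assert (hb : no_bnd (kinds_of l ((x, A) :: G) D)) by (intro; reflexivity).
  assert (hs' : skel (kinds_of l G D) (ALam (Non l) (ren (Free x) (Bnd 0) s))).
  { constructor; [|discriminate]. eapply skel_close; [exact hs|exact hb| |].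
    - simpl. destruct (in_dec Nat.eq_dec x (dom D)); [tauto|].
      destruct (Nat.eq_dec x x); [reflexivity|congruence].
    - intros y hy. simpl. destruct (in_dec Nat.eq_dec y (dom D)); [reflexivity|].
      destruct (Nat.eq_dec x y); [congruence|].
      destruct (in_dec Nat.eq_dec y (dom G)); reflexivity. }
  constructor; auto.
  - unfold lam. simpl. now rewrite erase_ren_close, he.
  - intros y hy. rewrite count_close_free; [|intros ->; tauto]. auto.
  - split; [lia|]. now apply all_levels_ren.
  - intros r e g hg hG hD. split.
    { apply lcat_msub; [assumption|]. eapply skel_lcat; exact hs'. }
    intros [|[[|j] u] st]; try now intros [].
    intros [-> [hu hst]]. apply safe_lam.
    rewrite open_msub_close; [|assumption|eapply skel_lcat; exact hs].
    apply (hm r e); [| | |exact hst].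
    + intro y. unfold updn. destruct (Nat.eqb x y); [apply hu|auto].
    + intros y C [hy|hy].
      * injection hy as <- <-. now rewrite updn_same.
      * rewrite updn_other; auto. intros ->. apply in_dom in hy; tauto.
    + intros y C hy. rewrite updn_other; auto.
      intros ->. apply in_dom in hy; tauto.
Qed.

Lemma annot_lin_e G1 G2 D1 D2 t u A B n1 n2 l s1 s2 :
  wf_ctxs (G1 ++ G2) (D1 ++ D2) ->
  annot G1 D1 t (TLin A B) n1 l s1 -> annot G2 D2 u A n2 l s2 ->
  annot (G1 ++ G2) (D1 ++ D2) (App t u) B (Nat.max n1 n2) l (AApp Lin s1 s2).
Proof.
  intros hw h1 h2.
  pose proof (wf_ctxs_app_disjoint _ _ _ _ hw) as [hdis hdis'].
  assert (hc : forall x, In x (dom (D1 ++ D2)) ->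
    count (Free x) (AApp Lin s1 s2) <= 1).
  { intros x hx. change (count (Free x) s1 + count (Free x) s2 <= 1).
    destruct (in_dec Nat.eq_dec x (dom D1)) as [i|i].
    - destruct (hdis x i). pose proof (an_count _ _ _ _ _ _ _ h1 x i).
      rewrite (count_outside _ _ _ s2 x (an_skel _ _ _ _ _ _ _ h2)); auto. lia.
    - rewrite dom_app, in_app_iff in hx. destruct hx as [hx|hx]; [tauto|].
      pose proof (an_count _ _ _ _ _ _ _ h2 x hx).
      destruct (hdis' x hx).
      rewrite (count_outside _ _ _ s1 x (an_skel _ _ _ _ _ _ _ h1)); auto. }
  apply annot_incl with (G' := G1 ++ G2) (D' := D1 ++ D2) (n' := Nat.max n1 n2) in h1;
    auto using incl_appl, incl_refl, Nat.le_max_l.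
  apply annot_incl with (G' := G1 ++ G2) (D' := D1 ++ D2) (n' := Nat.max n1 n2) in h2;
    auto using incl_appr, incl_refl, Nat.le_max_r.
  destruct h1 as [he1 hs1 _ hl1 hm1], h2 as [he2 hs2 _ hl2 hm2].
  constructor; auto.
  - simpl. congruence.
  - now constructor.
  - simpl. auto.
  - intros r e g hg hG hD.
    destruct (hm1 r e g hg hG hD) as [k1 h1], (hm2 r e g hg hG hD) as [k2 h2].
    split; [split; assumption|]. intros st hst. simpl. apply safe_app, h1.
    simpl. split; [split|]; assumption.
Qed.

(** In the premise [z] is linear at level [S l]; in the conclusion it is non-linear of level [l],
    hence again realized at [S l], and the same value serves both. This is the source of open
    arguments. *)
Lemma annot_imp_e G D z C t u A B n1 n2 l s1 s2 :
  wf_ctxs ((z, C) :: G) D ->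
  annot G D t (TImp A B) n1 l s1 -> annot [] [(z, C)] u A n2 (S l) s2 ->
  annot ((z, C) :: G) D (App t u) B (Nat.max n1 (S n2)) l (AApp (Non l) s1 s2).
Proof.
  intros hw h1 [he2 hs2 hc2 hl2 hm2].
  apply annot_incl with (G' := (z, C) :: G) (D' := D) (n' := Nat.max n1 (S n2)) in h1;
    auto using incl_tl, incl_refl, Nat.le_max_l.
  destruct h1 as [he1 hs1 hc1 hl1 hm1].
  constructor; auto.
  - simpl. congruence.
  - apply wf_app_open with (Free z); auto.
    + simpl. destruct (in_dec Nat.eq_dec z (dom D)) as [i|].
      * elim (wf_ctxs_disjoint _ _ z hw); simpl; auto.
      * destruct (Nat.eq_dec z z); congruence.
    + eapply wf_kinds; [|exact hs2]. intros [x|i]; simpl; [|exact I].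
      destruct (Nat.eq_dec z x) as [->|]; [|exact I].
      unfold only. rewrite upd_same. discriminate.
    + apply hc2. left; reflexivity.
    + eapply all_levels_impl; [|exact hl2]. simpl; intros; lia.
  - simpl. split; [lia|]. split; [assumption|].
    eapply all_levels_impl; [|exact hl2]. simpl; intros; lia.
  - intros r e g hg hG hD.
    destruct (hm1 r e g hg hG hD) as [k1 h1].
    assert (h2 : realizes (stacks A r e (S l)) (msub g s2)).
    { apply hm2; auto; [intros x E []|].
      intros x E [hx|[]]. injection hx as <- <-. apply hG. left; reflexivity. }
    split; [split; [assumption|apply h2]|]. intros st hst. simpl.
    apply safe_app, h1. simpl. auto.
Qed.

Lemma annot_imp_e0 G D t u A B n1 n2 l s1 s2 :
  annot G D t (TImp A B) n1 l s1 -> annot [] [] u A n2 (S l) s2 -> wf_ctxs G D ->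
  annot G D (App t u) B (Nat.max n1 (S n2)) l (AApp (Non l) s1 s2).
Proof.
  intros h1 [he2 hs2 hc2 hl2 hm2] hw.
  apply annot_incl with (G' := G) (D' := D) (n' := Nat.max n1 (S n2)) in h1;
    auto using incl_refl, Nat.le_max_l.
  destruct h1 as [he1 hs1 hc1 hl1 hm1].
  constructor; auto.
  - simpl. congruence.
  - apply wf_app_closed; auto.
    + eapply wf_kinds; [|exact hs2]. intros [x|i]; exact I.
    + eapply all_levels_impl; [|exact hl2]. simpl; intros; lia.
  - simpl. split; [lia|]. split; [assumption|].
    eapply all_levels_impl; [|exact hl2]. simpl; intros; lia.
  - intros r e g hg hG hD.
    destruct (hm1 r e g hg hG hD) as [k1 h1].
    assert (h2 : realizes (stacks A r e (S l)) (msub g s2))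
      by (apply hm2; auto; intros x E []).
    split; [split; [assumption|apply h2]|]. intros st hst. simpl.
    apply safe_app, h1. simpl. auto.
Qed.

Lemma skel_ren_non K R l x y s :
  skel K s -> K (Free x) = Some (Non l) -> R (Free y) = Some (Non l) ->
  (forall z, z <> Free x -> K z = None \/ R z = K z) ->
  skel R (ren (Free x) (Free y) s).
Proof. intros hs hx hy hR. apply wf_ren with K; auto. right; congruence. Qed.

Lemma count_ren_free x y z s :
  z <> x -> z <> y -> count (Free z) (ren (Free x) (Free y) s) = count (Free z) s.
Proof.
  intros hx hy. unfold count, occ. rewrite weight_ren. apply weight_ext. intro w.
  destruct (var_eq_dec (Free x) w) as [<-|n].
  - rewrite upd_same. unfold ind. rewrite !upd_other; congruence.
  - now rewrite upd_other.
Qed.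

Lemma annot_cntr G D x x1 x2 A t B n l s :
  wf_ctxs ((x, A) :: G) D -> wf_ctxs ((x1, A) :: (x2, A) :: G) D ->
  annot ((x1, A) :: (x2, A) :: G) D t B n l s ->
  annot ((x, A) :: G) D (subst x2 (Var x) (subst x1 (Var x) t)) B n l
    (ren (Free x2) (Free x) (ren (Free x1) (Free x) s)).
Proof.
  intros hw hw' [he hs hc hl hm].
  assert (hd : forall y, In y (dom G) \/ In y (dom D) -> y <> x /\ y <> x1 /\ y <> x2).
  { intros y hy. destruct hw as [h _], hw' as [h' _]. simpl in h, h'.
    inversion h as [|? ? i _]. inversion h' as [|? ? i1 h'']. inversion h'' as [|? ? i2 _].
    simpl in i1. rewrite dom_app in *. rewrite in_app_iff in *.
    repeat split; intros ->; tauto. }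
  assert (hxD : ~ In x (dom D) /\ ~ In x1 (dom D) /\ ~ In x2 (dom D)).
  { repeat split; intro i; apply hd in i || (specialize (hd _ (or_intror i))); tauto. }
  constructor; auto.
  - now rewrite !erase_ren_free, he.
  - set (R := kinds_of l ((x, A) :: G) D).
    assert (hR : R (Free x) = Some (Non l)).
    { simpl. destruct (in_dec Nat.eq_dec x (dom D)); [tauto|].
      destruct (Nat.eq_dec x x); congruence. }
    (* Kinds between the two renamings: [x1] is already merged into [x], while [x2] still needs its
       non-linear kind. *)
    apply skel_ren_non with (K := upd R (Free x2) (Some (Non l))) (l := l);
      [| |exact hR|].
    + eapply skel_ren_non with (l := l); [exact hs| | |].
      * simpl. destruct (in_dec Nat.eq_dec x1 (dom D)); [tauto|].
        destruct (Nat.eq_dec x1 x1); congruence.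
      * unfold upd. destruct (var_eq_dec (Free x2) (Free x)); auto.
      * intros [y|i] hy; [|left; reflexivity].
        destruct (Nat.eq_dec y x2) as [->|n2].
        -- right. rewrite upd_same. simpl.
           destruct (in_dec Nat.eq_dec x2 (dom D)); [tauto|].
           destruct (Nat.eq_dec x1 x2); [congruence|].
           destruct (Nat.eq_dec x2 x2); congruence.
        -- rewrite upd_other by congruence. simpl.
           destruct (in_dec Nat.eq_dec y (dom D)); [right; reflexivity|].
           destruct (Nat.eq_dec x1 y); [congruence|].
           destruct (Nat.eq_dec x2 y); [congruence|].
           destruct (in_dec Nat.eq_dec y (dom G)); [right|left; reflexivity].
           destruct (Nat.eq_dec x y); reflexivity.
    + apply upd_same.
    + intros z hz. right. rewrite upd_other; congruence.
  - intros y hy. destruct (hd y (or_intror hy)) as (? & ? & ?).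
    rewrite !count_ren_free; auto.
  - now apply all_levels_ren, all_levels_ren.
  - intros r e g hg hG hD. rewrite !msub_ren. set (g' := updn _ _ _).
    assert (e1 : g' x1 = g x).
    { unfold g'. rewrite updn_same. unfold updn.
      destruct (Nat.eqb x2 x); reflexivity. }
    assert (e2 : g' x2 = g x).
    { unfold g'. destruct (Nat.eq_dec x1 x2) as [->|]; [exact e1|].
      rewrite updn_other, updn_same by assumption. reflexivity. }
    assert (e3 : forall y, In y (dom G) \/ In y (dom D) -> g' y = g y).
    { intros y hy. destruct (hd y hy) as (? & ? & ?). unfold g'.
      rewrite !updn_other; congruence. }
    apply hm.
    + intro y. unfold g', updn. destruct (Nat.eqb x1 y), (Nat.eqb x2 y); auto;
        destruct (Nat.eqb x2 x); auto.
    + intros y C [hy|[hy|hy]].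
      * injection hy as <- <-. rewrite e1. apply hG. left; reflexivity.
      * injection hy as <- <-. rewrite e2. apply hG. left; reflexivity.
      * rewrite e3 by (left; eapply in_dom; exact hy). apply hG. now right.
    + intros y C hy. rewrite e3 by (right; eapply in_dom; exact hy). auto.
Qed.

(** The annotated term is unchanged. Read at [S l], the premise fits [G], whose names become
    non-linear of level [l], and fits [D], because [TPar B] at [l] means [B] at [S l]. *)
Lemma annot_par_i G D t A n l s :
  annot [] (G ++ D) t A n (S l) s -> annot G (ctx_par D) t (TPar A) (S n) l s.
Proof.
  intros [he hs hc hl hm]. constructor; auto.
  - eapply wf_kinds; [|exact hs]. intros [x|i]; simpl; [|exact I].
    rewrite dom_par, dom_app.
    destruct (in_dec Nat.eq_dec x (dom G ++ dom D)) as [i|i]; [|exact I].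
    destruct (in_dec Nat.eq_dec x (dom D)); [discriminate|].
    destruct (in_dec Nat.eq_dec x (dom G)); [discriminate|].
    apply in_app_or in i; tauto.
  - intros x hx. rewrite dom_par in hx. apply hc. rewrite dom_app, in_app_iff. auto.
  - eapply all_levels_impl; [|exact hl]. simpl; intros; lia.
  - intros r e g hg hG hD. simpl. apply (hm r e); auto.
    + intros x B [].
    + intros x B hx. apply in_app_or in hx as [hx|hx]; [auto|].
      apply (hD x (TPar B)). unfold ctx_par. now apply in_map_iff; exists (x, B).
Qed.

Lemma annot_par_e G1 G2 D1 D2 x t u A B n1 n2 l s1 s2 :
  wf_ctxs (G1 ++ G2) (D1 ++ D2) -> wf_ctxs G2 ((x, TPar A) :: D2) ->
  annot G1 D1 u (TPar A) n1 l s1 ->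
  annot G2 ((x, TPar A) :: D2) t B n2 l s2 ->
  annot (G1 ++ G2) (D1 ++ D2) (subst x u t) B (Nat.max n1 n2) l
    (sub (Free x) s1 s2).
Proof.
  intros hw hw2 h1 [he2 hs2 hc2 hl2 hm2].
  assert (hx : ~ In x (dom G2) /\ ~ In x (dom D2)).
  { destruct hw2 as [h _]. rewrite dom_app in h. simpl in h.
    apply NoDup_remove_2 in h. rewrite in_app_iff in h. tauto. }
  pose proof (wf_ctxs_app_disjoint _ _ _ _ hw) as [hdis hdis'].
  assert (hb : no_bnd (kinds_of l G1 D1)) by (intro; reflexivity).
  assert (hc : forall y, In y (dom (D1 ++ D2)) ->
    count (Free y) (sub (Free x) s1 s2) <= 1).
  { intros y hy.
    pose proof (an_skel _ _ _ _ _ _ _ h1) as hs1.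
    pose proof (hc2 x (or_introl eq_refl)) as hcx.
    (* The name [x] may reappear in [D1]; its count is then bounded by a product of two counts. *)
    destruct (Nat.eq_dec y x) as [->|n].
    - pose proof (count_sub_same _ _ _ (Free x) _ s2 hs1 hb) as hsub.
      rewrite dom_app, in_app_iff in hy. destruct hy as [hy|hy]; [|tauto].
      pose proof (an_count _ _ _ _ _ _ _ h1 x hy). nia.
    - pose proof (count_sub _ _ _ (Free y) (Free x) _ s2 hs1 hb) as hsub.
      destruct (in_dec Nat.eq_dec y (dom D1)) as [i|i].
      + destruct (hdis y i). pose proof (an_count _ _ _ _ _ _ _ h1 y i).
        rewrite (count_outside _ _ _ s2 y hs2) in hsub; simpl; [nia|auto|].
        intros [<-|]; tauto.
      + rewrite dom_app, in_app_iff in hy. destruct hy as [hy|hy]; [tauto|].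
        destruct (hdis' y hy).
        rewrite (count_outside _ _ _ s1 y hs1) in hsub; auto.
        pose proof (hc2 y (or_intror hy)). lia. }
  apply annot_incl with (G' := G1 ++ G2) (D' := D1 ++ D2) (n' := Nat.max n1 n2) in h1
    as h1'; auto using incl_appl, incl_refl, Nat.le_max_l.
  destruct h1 as [_ hs1 _ _ _], h1' as [he1 hs1' _ hl1 hm1].
  assert (hK : kinds_le (kinds_of l G1 D1) (kinds_of l (G1 ++ G2) (D1 ++ D2))).
  { apply kinds_of_incl.
    - rewrite dom_app; apply incl_appl, incl_refl.
    - rewrite dom_app; apply incl_appl, incl_refl.
    - intro y; now apply wf_ctxs_disjoint. }
  constructor; auto.
  - rewrite erase_sub_free. congruence.
  - eapply wf_sub_lin; [exact hs2| |exact hs1|exact hb|exact hK|].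
    + simpl. destruct (Nat.eq_dec x x); congruence.
    + intros [y|i] hy; [|left; reflexivity]. simpl.
      assert (y <> x) by congruence. rewrite !dom_app.
      destruct (Nat.eq_dec x y); [congruence|].
      destruct (in_dec Nat.eq_dec y (dom D2)) as [i|i].
      * right. destruct (in_dec Nat.eq_dec y (dom D1 ++ dom D2)) as [|j]; [reflexivity|].
        elim j; rewrite in_app_iff; auto.
      * destruct (in_dec Nat.eq_dec y (dom G2)) as [j|j]; [right|left; reflexivity].
        destruct (in_dec Nat.eq_dec y (dom D1 ++ dom D2)) as [k|k].
        -- apply in_app_or in k as [k|k]; [|tauto]. now apply hdis in k.
        -- destruct (in_dec Nat.eq_dec y (dom G1 ++ dom G2)) as [|k']; [reflexivity|].
           elim k'; rewrite in_app_iff; auto.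
  - apply all_levels_sub; [|assumption].
    eapply all_levels_impl; [|exact hl2]. simpl; intros; lia.
  - intros r e g hg hG hD. rewrite msub_sub.
    pose proof (hm1 r e g hg hG hD) as h1.
    apply hm2.
    + intro y. unfold updn. destruct (Nat.eqb x y); [apply h1|auto].
    + intros y C hy. rewrite updn_other.
      * apply hG, in_or_app; auto.
      * intros ->. apply in_dom in hy; tauto.
    + intros y C [hy|hy].
      * injection hy as <- <-. now rewrite updn_same.
      * rewrite updn_other; [apply hD, in_or_app; auto|].
        intros ->. apply in_dom in hy; tauto.
Qed.

Lemma annot_all_i G D t a A n l s :
  Forall (fun p => ~ In a (ftv (snd p))) (G ++ D) -> wf_ctxs G D -> lc_ty A ->
  annot G D t A n l s -> annot G D t (ty_all a A) n l s.
Proof.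
  intros ha hw hA [he hs hc hl hm]. constructor; auto.
  intros r e g hg hG hD.
  assert (h : forall X, realizes (stacks A (updr r a X) e l) (msub g s)).
  { intro X.
    assert (hr : forall x B, In (x, B) (G ++ D) -> forall l' s',
      stacks B (updr r a X) e l' s' <-> stacks B r e l' s').
    { intros x B hB l' s'. rewrite Forall_forall in ha. specialize (ha _ hB).
      destruct hw as [_ hw]. rewrite Forall_forall in hw. specialize (hw _ hB).
      apply stacks_ext with 0; [exact hw| |lia].
      intros b hb l'' s''. unfold updr. destruct (Nat.eqb_spec a b) as [->|]; tauto. }
    apply hm; auto; intros x B hB.
    - rewrite (realizes_iff _ (stacks B r e (S l))); auto.
      intro. eapply hr, in_or_app; eauto.
    - rewrite (realizes_iff _ (stacks B r e l)); auto.
      intro. eapply hr, in_or_app; eauto. }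
  (* Local closure does not depend on the candidate, so any one will do. *)
  split; [apply (h (fun _ _ => True))|].
  intros st [X hX]. apply stacks_close in hX. apply (h X).
  eapply stacks_ext; [exact hA| |lia|exact hX]. tauto.
Qed.

(** Candidates are arbitrary families of sets of stacks, in particular the interpretation of [B]. *)
Lemma annot_all_e G D t A B n l s :
  lc_ty B -> lc_ty (TAll A) ->
  annot G D t (TAll A) n l s -> annot G D t (ty_inst A B) n l s.
Proof.
  intros hB hA [he hs hc hl hm]. constructor; auto.
  intros r e g hg hG hD. destruct (hm r e g hg hG hD) as [h1 h2].
  split; [assumption|]. intros st hst. apply h2. exists (stacks B r e).
  unfold ty_inst in hst.
  apply stacks_open with (e' := fun i => if i =? 0 then stacks B r e else e i) in hst;
    auto; simpl; try tauto.
  - eapply stacks_ext; [exact hA| | |exact hst]; [tauto|].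
    intros i hi. destruct i; [simpl; tauto|lia].
  - intros [|i] hi; simpl; tauto.
Qed.

(** The three parts share the linear context; counts stay at most 1 because [weight] takes a maximum
    over them. *)
Lemma annot_bool_e G D k M0 M1 M2 A n0 n1 n2 l s0 s1 s2 :
  wf_ctxs G D ->
  annot G D M0 (pars k TBool) n0 l s0 -> annot G D M1 A n1 l s1 ->
  annot G D M2 A n2 l s2 ->
  annot G D (If M0 M1 M2) A (Nat.max n0 (Nat.max n1 n2)) l (AIf s0 s1 s2).
Proof.
  intros hw h0 h1 h2. set (n := Nat.max _ _).
  apply annot_incl with (G' := G) (D' := D) (n' := n) in h0, h1, h2;
    auto using incl_refl; try (unfold n; lia).
  destruct h0 as [he0 hs0 hc0 hl0 hm0], h1 as [he1 hs1 hc1 hl1 hm1],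
    h2 as [he2 hs2 hc2 hl2 hm2].
  constructor; auto.
  - simpl. congruence.
  - now constructor.
  - intros x hx. specialize (hc0 x hx); specialize (hc1 x hx); specialize (hc2 x hx).
    unfold count, occ in *. simpl. lia.
  - simpl; auto.
  - intros r e g hg hG hD.
    destruct (hm0 r e g hg hG hD) as [k0 h0], (hm1 r e g hg hG hD) as [k1 h1],
      (hm2 r e g hg hG hD) as [k2 h2].
    split; [simpl; auto|]. intros st hst. constructor; [simpl; auto|].
    intros q hq. inversion hq; subst; auto. apply h0, stacks_pars_bool.
Qed.

(** The level is quantified under the derivation, because the premise of [d_par_i] and the arguments
    in [d_imp_e] and [d_imp_e0] are annotated from the next level on. *)
Lemma annot_exists G D t A (X : deriv G D t A) :
  forall l, exists s, annot G D t A (depth X) l s.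
Proof.
  induction X; intro lv; simpl.
  - destruct (IHX lv) as [s h]. exists s. eapply annot_incl; [| | | |exact h]; auto.
    + intros a ha. now apply (Permutation_in _ p).
    + intros a ha. now apply (Permutation_in _ p0).
    + eapply wf_ctxs_perm; eauto. exact (proj1 (deriv_regular _ _ _ _ X)).
  - exists (AVar (Free x)). constructor; simpl; auto.
    + apply wf_var with Lin. simpl. destruct (Nat.eq_dec x x); congruence.
    + intros y [<-|[]]. unfold count, occ, ind; simpl. rewrite upd_same; lia.
  - destruct (IHX lv) as [s h]. eexists. apply annot_lin_i; [|exact h].
    exact (proj1 (deriv_regular _ _ _ _ X)).
  - destruct (IHX1 lv) as [s1 h1], (IHX2 lv) as [s2 h2].
    eexists. now apply annot_lin_e with A; [|exact h1|exact h2].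
  - destruct (IHX lv) as [s h]. eexists. apply annot_imp_i; [|exact h].
    exact (proj1 (deriv_regular _ _ _ _ X)).
  - destruct (IHX1 lv) as [s1 h1], (IHX2 (S lv)) as [s2 h2].
    eexists. now apply annot_imp_e with A; [|exact h1|exact h2].
  - destruct (IHX1 lv) as [s1 h1], (IHX2 (S lv)) as [s2 h2].
    eexists. apply annot_imp_e0 with A; [exact h1|exact h2|].
    exact (proj1 (deriv_regular _ _ _ _ X1)).
  - destruct (IHX lv) as [s h]. exists s.
    eapply annot_incl; [| | |reflexivity|exact h]; auto using incl_appl, incl_refl.
  - destruct (IHX lv) as [s h]. eexists. apply annot_cntr; [|  |exact h]; auto.
    exact (proj1 (deriv_regular _ _ _ _ X)).
  - destruct (IHX (S lv)) as [s h]. exists s. now apply annot_par_i.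
  - destruct (IHX1 lv) as [s1 h1], (IHX2 lv) as [s2 h2].
    eexists. apply annot_par_e with A; [assumption| |exact h1|exact h2].
    exact (proj1 (deriv_regular _ _ _ _ X2)).
  - destruct (IHX lv) as [s h]. exists s. destruct (deriv_regular _ _ _ _ X).
    now apply annot_all_i.
  - destruct (IHX lv) as [s h]. exists s. destruct (deriv_regular _ _ _ _ X).
    now apply annot_all_e.
  - exists (ACst false). constructor; [reflexivity|constructor|intros x []|exact I|].
    intros r e g _ _ _. split; [exact I|]. intros st _.
    constructor; [simpl; auto|]. intros q hq; inversion hq.
  - exists (ACst true). constructor; [reflexivity|constructor|intros x []|exact I|].
    intros r e g _ _ _. split; [exact I|]. intros st _.
    constructor; [simpl; auto|]. intros q hq; inversion hq.
  - destruct (IHX1 lv) as [s0 h0], (IHX2 lv) as [s1 h1], (IHX3 lv) as [s2 h2].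
    eexists. eapply annot_bool_e; [|exact h0|exact h1|exact h2].
    exact (proj1 (deriv_regular _ _ _ _ X1)).
Qed.

(** * The machine *)

Fixpoint lc_term_at (k : nat) (t : term) : Prop :=
  match t with
  | Idx i => i < k
  | Lam t => lc_term_at (S k) t
  | App t u => lc_term_at k t /\ lc_term_at k u
  | If t u v => lc_term_at k t /\ lc_term_at k u /\ lc_term_at k v
  | _ => True
  end.

Lemma open_lc u t : forall j k, lc_term_at j t -> j <= k -> open_at k u t = t.
Proof.
  induction t; intros j k h hk; simpl in *; auto.
  - destruct (Nat.eqb_spec i k); [lia|reflexivity].
  - f_equal. apply IHt with (S j); auto; lia.
  - f_equal; [apply IHt1 with j|apply IHt2 with j]; tauto.
  - f_equal; [apply IHt1 with j|apply IHt2 with j|apply IHt3 with j]; tauto.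
Qed.

Lemma lc_open u t : lc_term_at 0 u -> forall k,
  lc_term_at (S k) t -> lc_term_at k (open_at k u t).
Proof.
  intro hu.
  assert (hk : forall t j k, j <= k -> lc_term_at j t -> lc_term_at k t).
  { clear. induction t; intros j k h; simpl; auto; try lia.
    - apply IHt; lia.
    - intros []; split; eauto.
    - intros (? & ? & ?); repeat split; eauto. }
  induction t; intros k h; simpl in *; auto; try tauto.
  - destruct (Nat.eqb_spec i k); simpl; [apply hk with 0; auto; lia|lia].
  - split; [apply IHt1|apply IHt2]; tauto.
  - split; [|split]; [apply IHt1|apply IHt2|apply IHt3]; tauto.
Qed.

Lemma subst_open x v u t : lc_term_at 0 v -> forall k,
  subst x v (open_at k u t) = open_at k (subst x v u) (subst x v t).
Proof.
  intro hv. induction t; intro k; simpl; try congruence.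
  - destruct (Nat.eqb x x0); [|reflexivity].
    symmetry. apply open_lc with 0; auto; lia.
  - destruct (Nat.eqb i k); reflexivity.
Qed.

Lemma subst_fresh x v t : ~ In x (fv t) -> subst x v t = t.
Proof.
  induction t; simpl; intro h; auto.
  - destruct (Nat.eqb_spec x x0); [|reflexivity]. subst; tauto.
  - f_equal; auto.
  - rewrite in_app_iff in h. f_equal; tauto.
  - rewrite !in_app_iff in h. f_equal; tauto.
Qed.

Lemma subst_inst x v t : ~ In x (fv t) -> forall k,
  subst x v (open_at k (Var x) t) = open_at k v t.
Proof.
  induction t; simpl; intros h k; auto.
  - destruct (Nat.eqb_spec x x0); [|reflexivity]. subst; tauto.
  - destruct (Nat.eqb i k); simpl; [|reflexivity]. now rewrite Nat.eqb_refl.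
  - f_equal; auto.
  - rewrite in_app_iff in h. f_equal; intuition.
  - rewrite !in_app_iff in h. f_equal; intuition.
Qed.

Lemma fv_open k y t : incl (fv (open_at k (Var y) t)) (y :: fv t).
Proof.
  revert k; induction t; intro k; simpl;
    try (intros z hz; simpl in *; rewrite ?in_app_iff in *; auto; fail).
  - destruct (Nat.eqb i k); intros z hz; simpl in *; tauto.
  - apply IHt.
  - intros z hz. specialize (IHt1 k z). specialize (IHt2 k z). simpl in *.
    rewrite in_app_iff in *. tauto.
  - intros z hz. specialize (IHt1 k z). specialize (IHt2 k z). specialize (IHt3 k z).
    simpl in *. rewrite !in_app_iff in *. tauto.
Qed.

(** Terms assigned later may mention names assigned earlier, so the last assignment is substituted
    first. *)
Fixpoint expand (E : env) (t : term) : term :=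
  match E with
  | [] => t
  | (x, N) :: E => subst x N (expand E t)
  end.

Lemma expand_app E1 E2 t : expand (E1 ++ E2) t = expand E1 (expand E2 t).
Proof. induction E1 as [|[x N] E1 IH]; simpl; congruence. Qed.

Definition lc_env (E : env) : Prop := Forall (fun p => lc_term_at 0 (snd p)) E.

Lemma expand_open E u t k : lc_env E ->
  expand E (open_at k u t) = open_at k (expand E u) (expand E t).
Proof.
  induction 1 as [|[x N] E h _ IH]; simpl; [reflexivity|].
  rewrite IH. now apply subst_open.
Qed.

Lemma expand_App E t u : expand E (App t u) = App (expand E t) (expand E u).
Proof. induction E as [|[x N] E IH]; simpl; [|rewrite IH]; reflexivity. Qed.

Lemma expand_Lam E t : expand E (Lam t) = Lam (expand E t).
Proof. induction E as [|[x N] E IH]; simpl; [|rewrite IH]; reflexivity. Qed.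

Lemma expand_If E t u v :
  expand E (If t u v) = If (expand E t) (expand E u) (expand E v).
Proof. induction E as [|[x N] E IH]; simpl; [|rewrite IH]; reflexivity. Qed.

Lemma expand_TT E : expand E TT = TT.
Proof. induction E as [|[x N] E IH]; simpl; [|rewrite IH]; reflexivity. Qed.

Lemma expand_FF E : expand E FF = FF.
Proof. induction E as [|[x N] E IH]; simpl; [|rewrite IH]; reflexivity. Qed.

Lemma expand_apps E t us :
  expand E (apps t us) = apps (expand E t) (map (expand E) us).
Proof.
  revert t; induction us as [|u us IH]; intro t; simpl; [reflexivity|].
  now rewrite IH, expand_App.
Qed.

Lemma expand_fresh E t : (forall x, In x (fv t) -> ~ In x (map fst E)) -> expand E t = t.
Proof.
  induction E as [|[x N] E IH]; simpl; intro h; [reflexivity|].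
  rewrite IH; [|firstorder]. apply subst_fresh. firstorder.
Qed.

Lemma apps_snoc t us u : apps t (us ++ [u]) = App (apps t us) u.
Proof. unfold apps. apply fold_left_app. Qed.

Lemma lc_apps t us :
  lc_term_at 0 (apps t us) <-> lc_term_at 0 t /\ Forall (lc_term_at 0) us.
Proof.
  revert t; induction us as [|u us IH]; intro t; simpl.
  - intuition.
  - rewrite IH, Forall_cons_iff. simpl. tauto.
Qed.

Lemma in_fv_apps x t us :
  In x (fv (apps t us)) <-> In x (fv t) \/ In x (flat_map fv us).
Proof.
  revert t; induction us as [|u us IH]; intro t; simpl; [tauto|].
  rewrite IH. simpl. rewrite !in_app_iff. tauto.
Qed.

Definition is_app (t : term) : Prop :=
  match t with App _ _ => True | _ => False end.

Lemma apps_inj t t' us : forall us',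
  ~ is_app t -> ~ is_app t' -> apps t us = apps t' us' -> t = t' /\ us = us'.
Proof.
  induction us as [|u us IH] using rev_ind; intros us' ht ht';
    destruct us' as [|u' us' _] using rev_ind; rewrite ?apps_snoc; simpl; intro e.
  - auto.
  - subst t; now elim ht.
  - subst t'; now elim ht'.
  - injection e as e ->. destruct (IH us' ht ht' e) as [-> ->]. auto.
Qed.

Definition flat (p : process) : term :=
  apps (erase (fst p)) (map (fun e => erase (snd e)) (snd p)).

(** The machine keeps arguments applied to the head, whereas processes push them. Pushing them all
    exposes the head without changing [flat], and [apps_inj] can then compare both sides. *)
Lemma push_normal p : exists q,
  psteps p q /\ flat q = flat p /\ ~ is_app (erase (fst q)).
Proof.
  destruct p as [t s]; revert s; induction t as [[y|i]|[]|m t IH|m t IHt u IHu|];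
    intro s; try (eexists; split; [apply ps_refl|split; [reflexivity|simpl; tauto]]).
  destruct (IHt ((m, u) :: s)) as (q & h1 & h2 & h3).
  exists q. split; [|split; [exact h2|exact h3]].
  eapply ps_step; [constructor|exact h1].
Qed.

Inductive env_ok : env -> Prop :=
| env_nil : env_ok []
| env_snoc E x N :
    env_ok E -> ~ In x (env_vars E) -> lc_term_at 0 N ->
    incl (fv N) (map fst E) -> env_ok (E ++ [(x, N)]).

Lemma env_dom_vars E x : In x (map fst E) -> In x (env_vars E).
Proof.
  induction E as [|[y N] E IH]; simpl; [tauto|].
  rewrite in_app_iff. tauto.
Qed.

Lemma env_ok_lc E : env_ok E -> lc_env E.
Proof.
  induction 1; [constructor|]. apply Forall_app; split; [assumption|].
  repeat constructor. assumption.
Qed.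

Lemma env_ok_split E1 E2 x N :
  env_ok (E1 ++ [(x, N)] ++ E2) ->
  incl (fv N) (map fst E1) /\ lc_term_at 0 N /\
  (forall y, In y (x :: map fst E1) -> ~ In y (map fst E2)) /\
  ~ In x (map fst E1).
Proof.
  induction E2 as [|[y P] E2 IH] using rev_ind; intro h.
  - simpl in h. inversion h as [e|E y P hE hy hP hi e]; [now destruct E1|].
    apply app_inj_tail in e as [-> e]. injection e as -> ->.
    repeat split; auto. intro hx. now apply hy, env_dom_vars.
  - rewrite !app_assoc in h. inversion h as [e|E z Q hE hy hP hi e];
      [now destruct (E1 ++ [(x, N)]), E2|].
    apply app_inj_tail in e as [-> e]. injection e as -> ->.
    rewrite <- app_assoc in hE. destruct (IH hE) as (h1 & h2 & h3 & h4).
    repeat split; auto. intros z hz. rewrite map_app, in_app_iff. simpl.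
    intros [i|[->|[]]]; [now apply (h3 z)|].
    apply hy, env_dom_vars. rewrite !map_app, !in_app_iff. simpl. simpl in hz. tauto.
Qed.

Fixpoint head (t : term) : term :=
  match t with App t _ => head t | _ => t end.

Lemma head_apps t us : head (apps t us) = head t.
Proof. revert t; induction us as [|u us IH]; intro t; simpl; [|rewrite IH]; reflexivity. Qed.

(* Each head step strictly lowers the position in the environment of the name
   in head position. *)
Fixpoint rank_in (E : env) (x : name) : nat :=
  match E with
  | [] => 0
  | (y, _) :: E => if Nat.eqb x y then 1 else S (rank_in E x)
  end.

Definition rank (E : env) (t : term) : nat :=
  match head t with Var x => rank_in E x | _ => 0 end.

Lemma rank_in_le E x : rank_in E x <= length E.
Proof. induction E as [|[y N] E IH]; simpl; [lia|]. destruct (Nat.eqb x y); lia. Qed.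

Lemma rank_le E t : rank E t <= length E.
Proof. unfold rank. destruct (head t); auto using rank_in_le; lia. Qed.

Lemma rank_in_old E E' x : In x (map fst E) -> rank_in (E ++ E') x <= length E.
Proof.
  induction E as [|[y N] E IH]; simpl; [tauto|].
  destruct (Nat.eqb_spec x y); [lia|]. intros [->|h]; [congruence|].
  specialize (IH h). lia.
Qed.

Lemma rank_in_new E E' x N :
  ~ In x (map fst E) -> rank_in (E ++ (x, N) :: E') x = S (length E).
Proof.
  induction E as [|[y P] E IH]; simpl; intro h.
  - now rewrite Nat.eqb_refl.
  - destruct (Nat.eqb_spec x y); [subst; tauto|]. rewrite IH; tauto.
Qed.

Lemma head_fv t x : head t = Var x -> In x (fv t).
Proof.
  induction t; simpl; try discriminate.
  - intro e; injection e; auto.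
  - intro e. apply in_or_app. auto.
Qed.

(** * Simulation of the machine by processes *)

Definition good (d m : nat) (p : process) : Prop := safe p /\ proc_ok d m p.

Lemma good_step d m p q :
  good d m p -> pstep p q -> good d m q /\ proc_pot d m d q < proc_pot d m d p.
Proof.
  intros [[h1 h2] h3] hs. split; [split; [auto|now apply proc_ok_step with p]|].
  pose proof (proc_pot_step d m p q d h3 hs) as h. unfold wnode in h.
  rewrite Nat.eqb_refl in h. lia.
Qed.

Lemma good_steps d m p q :
  psteps p q -> good d m p -> good d m q /\ proc_pot d m d q <= proc_pot d m d p.
Proof.
  induction 1 as [p|p q r h1 h2 IH]; intro hp; [auto|].
  destruct (good_step d m p q hp h1) as [hq hlt]. destruct (IH hq). split; [auto|lia].
Qed.

(** [flat] matches [p] with the expanded term regardless of how many arguments are already pushed;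
    [n] bounds the process steps left. *)
Record conf_ok (d m n : nat) (E : env) (t : term) (p : process) : Prop := {
  co_env : env_ok E;
  co_lc : lc_term_at 0 t;
  co_fv : incl (fv t) (map fst E);
  co_good : good d m p;
  co_flat : flat p = expand E t;
  co_pot : proc_pot d m d p <= n
}.

Lemma map_eq_cons_erase (s : stack) u us :
  map (fun e => erase (snd e)) s = u :: us ->
  exists a v s', s = (a, v) :: s' /\ erase v = u /\ map (fun e => erase (snd e)) s' = us.
Proof.
  destruct s as [|[a v] s']; simpl; [discriminate|].
  intro e; injection e as e1 e2. eauto 6.
Qed.

Lemma conf_beta d m n E N N1 Ns x p :
  conf_ok d m n E (apps (Lam N) (N1 :: Ns)) p ->
  ~ In x (env_vars E) -> ~ In x (fv (apps (Lam N) (N1 :: Ns))) ->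
  exists n' q, n = S n' /\ conf_ok d m n' (E ++ [(x, N1)]) (apps (inst N x) Ns) q.
Proof.
  intros [hE hl hf hg hp hn] hx1 hx2.
  destruct (push_normal p) as (q & h1 & h2 & h3).
  destruct (good_steps _ _ _ _ h1 hg) as [hg' hle]. clear h1 hg.
  rewrite hp, expand_apps, expand_Lam in h2. destruct q as [t s]. simpl in h3.
  unfold flat in h2; simpl fst in h2; simpl snd in h2.
  apply apps_inj in h2 as [e1 e2]; [|assumption|simpl; tauto].
  destruct t as [[]|[]|a t| |]; try discriminate. simpl in e1. injection e1 as e1.
  apply map_eq_cons_erase in e2 as (b & u & s' & -> & e2 & e3).
  change (map (fun e => erase (snd e)) s' = map (expand E) Ns) in e3.
  (* Safety rules out a clash, so the process can follow the machine. *)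
  assert (a = b) as <-.
  { destruct hg' as [[hc _] _]. simpl in hc.
    destruct (mode_eq_dec a b); [assumption|]. now elim hc. }
  destruct (good_step d m _ _ hg' (p_beta a t u s')) as [hg hlt].
  apply lc_apps in hl as [hl1 hl2]. inversion hl2 as [|? ? hl3 hl4]; subst.
  assert (hx : ~ In x (fv N) /\ ~ In x (flat_map fv Ns)).
  { rewrite in_fv_apps in hx2. simpl in hx2. rewrite in_app_iff in hx2. tauto. }
  exists (pred n), (sub (Bnd 0) u t, s'). split; [lia|].
  constructor; auto.
  - constructor; auto. intros y hy. apply hf. rewrite in_fv_apps. simpl.
    rewrite in_app_iff. tauto.
  - apply lc_apps. split; [|assumption]. apply lc_open; [exact I|exact hl1].
  - intros y hy. apply in_fv_apps in hy. rewrite map_app, in_app_iff. simpl.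
    destruct hy as [hy|hy].
    + apply fv_open in hy as [->|hy]; [auto|].
      left. apply hf. rewrite in_fv_apps. auto.
    + left. apply hf. rewrite in_fv_apps. simpl. rewrite in_app_iff. auto.
  - unfold flat. simpl fst. simpl snd. rewrite erase_sub_bnd, e3, e1.
    rewrite expand_app, !expand_apps.
    (* As [x] is fresh, expanding the new assignment performs the substitution made by the process,
       and leaves [Ns] alone. *)
    assert (he : expand [(x, N1)] (inst N x) = open_at 0 N1 N).
    { simpl. apply subst_inst; tauto. }
    rewrite he, expand_open by now apply env_ok_lc.
    rewrite map_map. f_equal; [now rewrite e2|].
    apply map_ext_in. intros w hw. simpl. rewrite subst_fresh; [reflexivity|].
    intro i. apply hx. apply in_flat_map. eauto.
  - lia.
Qed.

Lemma conf_if d m n E M0 M1 M2 Ns p :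
  conf_ok d m n E (apps (If M0 M1 M2) Ns) p ->
  exists n' q0 q1 q2, n = S n' /\ conf_ok d m n' E M0 q0 /\
    conf_ok d m n' E (apps M1 Ns) q1 /\ conf_ok d m n' E (apps M2 Ns) q2.
Proof.
  intros [hE hl hf hg hp hn].
  destruct (push_normal p) as (q & h1 & h2 & h3).
  destruct (good_steps _ _ _ _ h1 hg) as [hg' hle]. clear h1 hg.
  rewrite hp, expand_apps, expand_If in h2. destruct q as [t s]. simpl in h3.
  unfold flat in h2; simpl fst in h2; simpl snd in h2.
  apply apps_inj in h2 as [e1 e2]; [|assumption|simpl; tauto].
  destruct t as [[]|[]| | |t0 t1 t2]; try discriminate.
  simpl in e1. injection e1 as e0 e1 e3.
  destruct (good_step d m _ _ hg' (p_if0 t0 t1 t2 s)) as [g0 lt0].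
  destruct (good_step d m _ _ hg' (p_if1 t0 t1 t2 s)) as [g1 lt1].
  destruct (good_step d m _ _ hg' (p_if2 t0 t1 t2 s)) as [g2 lt2].
  apply lc_apps in hl as [(l0 & l1 & l2) hl].
  assert (hf' : forall x,
    (In x (fv M0) \/ In x (fv M1) \/ In x (fv M2)) \/ In x (flat_map fv Ns) ->
    In x (map fst E)).
  { intros x hx. apply hf. rewrite in_fv_apps. simpl. now rewrite !in_app_iff. }
  exists (pred n), (t0, []), (t1, s), (t2, s). split; [lia|].
  split; [|split]; constructor; auto; try lia.
  - intros x hx; apply hf'; auto.
  - now apply lc_apps.
  - intros x hx; apply in_fv_apps in hx as [hx|hx]; apply hf'; auto.
  - rewrite expand_apps. unfold flat; simpl fst; simpl snd. congruence.
  - now apply lc_apps.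
  - intros x hx; apply in_fv_apps in hx as [hx|hx]; apply hf'; auto.
  - rewrite expand_apps. unfold flat; simpl fst; simpl snd. congruence.
Qed.

(** By [env_ok], [N] mentions only names of [E1]. Hence [x] and [N] have the same expansion, and the
    new head is a name of [E1] or has rank 0. *)
Lemma conf_head d m n E1 E2 x N Ns p :
  let E := E1 ++ [(x, N)] ++ E2 in
  conf_ok d m n E (apps (Var x) Ns) p ->
  conf_ok d m n E (apps N Ns) p /\ rank E (apps N Ns) < rank E (apps (Var x) Ns).
Proof.
  intros E [hE hl hf hg hp hn].
  destruct (env_ok_split _ _ _ _ hE) as (h1 & h2 & h3 & h4).
  assert (hN : incl (fv N) (map fst E)).
  { intros y hy. unfold E. rewrite map_app, in_app_iff. auto. }
  split.
  - constructor; auto.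
    + apply lc_apps in hl as [_ hl]. now apply lc_apps.
    + intros y hy. apply in_fv_apps in hy as [hy|hy]; [auto|].
      apply hf. rewrite in_fv_apps. auto.
    + rewrite hp, !expand_apps. f_equal. unfold E. rewrite !expand_app.
      rewrite (expand_fresh E2 (Var x)).
      * rewrite (expand_fresh E2 N).
        -- simpl. rewrite Nat.eqb_refl. rewrite subst_fresh; [reflexivity|].
           intro i. now apply h4, h1.
        -- intros y hy. apply h3. right. now apply h1.
      * intros y [<-|[]]. apply h3. left; reflexivity.
  - unfold rank. rewrite !head_apps. simpl (head (Var x)); cbv match.
    replace (rank_in E x) with (S (length E1))
      by (symmetry; now apply rank_in_new).
    destruct (head N) as [y| | | | | |] eqn:e; try lia.
    apply head_fv, h1 in e.
    apply Nat.lt_succ_r, (rank_in_old E1 ([(x, N)] ++ E2) y e).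
Qed.

(** A constant weighs 1 at [k = d], which pays for the final transition. *)
Lemma conf_const d m n E t p :
  t = TT \/ t = FF -> conf_ok d m n E t p -> 0 < n.
Proof.
  intros ht [hE hl hf hg hp hn].
  destruct (push_normal p) as (q & h1 & h2 & h3).
  destruct (good_steps _ _ _ _ h1 hg) as [_ hle].
  assert (e : expand E t = t).
  { destruct ht as [-> | ->]; [apply expand_TT|apply expand_FF]. }
  rewrite hp, e in h2. destruct q as [s st].
  unfold flat in h2; simpl fst in h2; simpl snd in h2.
  apply (apps_inj _ t _ []) in h2 as [e1 e2];
    [|assumption|destruct ht as [-> | ->]; simpl; tauto].
  destruct s as [[]|b| | |]; simpl in e1; subst t; try (destruct ht; discriminate).
  assert (h0 : proc_pot d m d (ACst b, st) >= 1).
  { unfold proc_pot, pot. simpl. unfold wnode. rewrite Nat.eqb_refl. lia. }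
  lia.
Qed.

(** Beta and conditional steps each consume a unit of [n]. The factor [Z + 3] covers such a step,
    the exit from a universal configuration, and the following head steps, at most [Z] since they
    lower the rank. A beta step lengthens [E] by one but lowers [n], so [Z] keeps bounding the
    sum. *)
Lemma conf_time d m Z : forall l E b t c n p,
  path l (CEx E b t) c -> conf_ok d m n E t p -> n + length E <= Z ->
  l <= n * (Z + 3) + rank E t.
Proof.
  induction l as [l IH] using lt_wf_ind; intros E b t c n p hpath hp hZ.
  inversion hpath as [|l' ? c1 ? hs hpath']; subst; [lia|]. clear hpath.
  assert (hif : forall n' N0 q0 N1 q1 a b', n = S n' ->
    c1 = CAll E a N0 b' N1 ->
    conf_ok d m n' E N0 q0 -> conf_ok d m n' E N1 q1 ->
    S l' <= n * (Z + 3) + rank E t).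
  { intros n' N0 q0 N1 q1 a b' -> -> h0 h1.
    inversion hpath' as [|l'' ? c2 ? hs' hpath'']; subst; [lia|].
    pose proof (rank_le E N0). pose proof (rank_le E N1).
    inversion hs'; subst.
    - pose proof (IH l'' ltac:(lia) _ _ _ _ _ _ hpath'' h0 ltac:(lia)). lia.
    - pose proof (IH l'' ltac:(lia) _ _ _ _ _ _ hpath'' h1 ltac:(lia)). lia. }
  assert (hend : (t = TT \/ t = FF) -> c1 = Accepting \/ c1 = Rejecting ->
    S l' <= n * (Z + 3) + rank E t).
  { intros ht hc. pose proof (conf_const _ _ _ _ _ _ ht hp).
    assert (l' = 0) as ->; [|lia].
    destruct hc as [-> | ->]; inversion hpath' as [|? ? ? ? hs']; subst; auto;
      inversion hs'. }
  inversion hs as [? ? N N1 Ns x' hx1 hx2| | | | | | | | |]; subst; auto.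
  - destruct (conf_beta _ _ _ _ _ _ _ _ _ hp hx1 hx2) as (n' & q & -> & hq).
    pose proof (rank_le (E ++ [(x', N1)]) (apps (inst N x') Ns)) as hr.
    rewrite length_app in hr. simpl in hr.
    eapply (IH l') in hpath'; [|lia|exact hq|rewrite length_app; simpl; lia]. lia.
  - apply conf_head in hp as [hp hr]. cbv zeta in hp, hr. simpl app in *.
    pose proof (IH l' ltac:(lia) _ _ _ _ _ _ hpath' hp hZ). lia.
  - destruct (conf_if _ _ _ _ _ _ _ _ _ hp) as (n' & q0 & q1 & q2 & e & h0 & h1 & h2).
    eapply hif; eauto.
  - destruct (conf_if _ _ _ _ _ _ _ _ _ hp) as (n' & q0 & q1 & q2 & e & h0 & h1 & h2).
    eapply hif; eauto.
Qed.

(** For size 1 the bound is 1 whatever the exponent, while the potentials are set up for [m >= 2].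
    Such a term is a constant, which makes one step, or is stuck in the empty environment. *)
Lemma path_size_1 M l c : size M = 1 -> path l (init M) c -> l <= 1.
Proof.
  intros hM hp. inversion hp as [|l' ? c1 ? hs hp']; subst; [lia|].
  assert (hz : forall t, size t > 0) by (induction t; simpl; lia).
  assert (happ : forall us t, size (apps t us) >= size t).
  { induction us as [|u us IH]; intro t; simpl; [lia|].
    specialize (IH (App t u)). simpl in IH. lia. }
  unfold init in hs. inversion hs; subst.
  - simpl in hM. pose proof (happ Ns (App (Lam N) N1)). simpl in *.
    pose proof (hz N). lia.
  - now destruct E1.
  - pose proof (happ Ns (If M0 M1 M2)). simpl in *. pose proof (hz M0). lia.
  - pose proof (happ Ns (If M0 M1 M2)). simpl in *. pose proof (hz M0). lia.
  - inversion hp' as [|? ? ? ? hs']; subst; [lia|inversion hs'].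
  - inversion hp' as [|? ? ? ? hs']; subst; [lia|inversion hs'].
Qed.

Lemma lcat_erase t : forall k, lcat k t -> lc_term_at k (erase t).
Proof.
  induction t as [[]|[]| | |]; intros k h; simpl in *; auto.
  - destruct h; auto.
  - destruct h as (? & ? & ?); auto.
Qed.

Lemma skel_none_fv t : forall K x, skel K t -> K (Free x) = None -> ~ In x (fv (erase t)).
Proof.
  intros K x h. unfold skel in h.
  induction h as [K [y|i] a e|K b|K a t _ IH c|K t u _ IHt _ IHu|K i t u _ IHt _ IHu hu _
    |K i y t u _ IHt e _ IHu c hu _|K t u w _ IHt _ IHu _ IHw]; intro hx; simpl;
    rewrite ?in_app_iff; try tauto.
  - intros [->|[]]. congruence.
  - destruct b; simpl; tauto.
  - intros [h|h]; [tauto|]. apply IHu in h; [assumption|].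
    unfold only. rewrite upd_other; [reflexivity|congruence].
Qed.

Lemma exponent_bound d : 12 * 2 ^ d <= 3 ^ (d + 3).
Proof.
  rewrite Nat.pow_add_r. pose proof (Nat.pow_le_mono_l 2 3 d). simpl (3 ^ 3). lia.
Qed.

Theorem theorem5 (M : term) (n : nat) (D : deriv [] [] M (pars n TBool))
    (l : nat) (c : config) (H : path l (init M) c) :
  l <= size M ^ (3 ^ (depth D + 3)).
Proof.
  destruct (Nat.eq_dec (size M) 1) as [e|n1].
  { rewrite e, Nat.pow_1_l. now apply path_size_1 with (2 := H). }
  assert (hm : 2 <= size M) by (destruct M; simpl in *; lia).
  destruct (annot_exists _ _ _ _ D 0) as [s [he hs _ hl hsem]].
  (* The levels of [s] run from 0 to [depth D], hence stay below [d], where all steps are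
     counted. *)
  set (d := S (depth D)). set (m := size M) in *.
  assert (hk : skel none s).
  { eapply wf_kinds; [|exact hs]. intros [x|i]; exact I. }
  assert (hok : conf_ok d m (m ^ (3 * 2 ^ d - 2)) [] M (s, [])).
  { constructor.
    - constructor.
    - rewrite <- he. apply lcat_erase. eapply skel_lcat; exact hs.
    - intros x hx. rewrite <- he in hx. now apply (skel_none_fv s none x) in hx.
    - split.
      (* The contexts are empty, so names may stand for themselves and any interpretation of type
         variables works. *)
      + rewrite <- (msub_id s).
        apply (hsem (fun _ _ _ => True) (fun _ _ _ => True)); simpl; try tauto.
        apply stacks_pars_bool.
      + apply proc_ok_init; auto; [|rewrite he; unfold m; lia].
        eapply all_levels_impl; [|exact hl]. simpl. unfold d. intros; lia.
    - simpl. assumption.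
    - unfold proc_pot. simpl. rewrite Nat.add_0_r.
      apply pot_init; [lia|]. rewrite he. unfold m; lia. }
  set (z := m ^ (3 * 2 ^ d - 2)) in *.
  pose proof (conf_time d m z _ _ _ _ _ _ _ H hok ltac:(simpl; lia)) as ht.
  unfold rank in ht.
  apply Nat.le_trans with (m ^ (12 * 2 ^ depth D));
    [|apply Nat.pow_le_mono_r; [lia|apply exponent_bound]].
  assert (hz : z <> 0) by (apply Nat.pow_nonzero; lia).
  assert (hd : 2 ^ depth D <> 0) by (apply Nat.pow_nonzero; lia).
  assert (hr : (match head M with Var x => rank_in [] x | _ => 0 end) = 0)
    by (destruct (head M); reflexivity).
  rewrite hr in ht.
  (* [conf_time] gives [z * (z + 3)], at most [2 ^ 4 * (z * z)] as [z] is positive; the 4 in the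
     exponent absorbs the constant since [m >= 2]. *)
  replace (12 * 2 ^ depth D) with (4 + ((3 * 2 ^ d - 2) + (3 * 2 ^ d - 2)))
    by (unfold d; rewrite Nat.pow_succ_r'; lia).
  rewrite 2!Nat.pow_add_r. fold z.
  assert (h4 : 2 ^ 4 <= m ^ 4) by (apply Nat.pow_le_mono_l; lia).
  simpl (2 ^ 4) in h4. nia.
Qed.
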